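(* HoTT proves that $(V,\in)$ is a model of $\mathbf{ECST}$; that is, in HoTT, for every axiom $\chi$ of $\mathbf{ECST}$ the type $[\![\chi]\!]_V$ is inhabited.
   Context: Work in HoTT: Martin-Löf type theory with the univalence axiom and higher inductive types, with universes $U:U'$ (no excluded middle, choice or propositional resizing assumed). $\mathrm{isProp}(P):\equiv\prod_{x,y:P}x=y$, $\mathrm{Prop}_U:\equiv\sum_{P:U}\mathrm{isProp}(P)$ (similarly for $U'$). The symbols $\exists,\vee$ denote the propositional truncations of $\Sigma,+$. The cumulative hierarchy $V:U'$ is the higher inductive type with constructors: $\mathsf{set}:\prod_{A:U}(A\to V)\to V$; for all $A,B:U$, $f:A\to V$, $g:B\to V$, a path $\mathsf{set}(A,f)=\mathsf{set}(B,g)$ whenever $(\forall(a:A).\exists(b:B).f(a)=g(b))\wedge(\forall(b:B).\exists(a:A).f(a)=g(b))$; and a $0$-truncation constructor (so $V$ is an h-set). Membership is defined by $x\in\mathsf{set}(A,f):\equiv\exists(a:A).x=f(a)$, a proposition in $U'$. Formulas $\phi$ of the first-order language $\{\in\}$ of set theory are translated into predicates $[\![\phi]\!]_V:V^k\to\mathrm{Prop}_{U'}$ ($k$ the number of free variables) by induction: $x=y$ as the identity type of $V$, $x\in y$ as membership above, $\neg\phi$ as $\phi\to\mathbf 0$, $\to,\wedge,\vee$ as the corresponding operations on propositions ($\vee$ truncated), $\exists x$ and $\forall x$ as the truncated $\exists(x:V)$ and $\prod_{x:V}$. $(V,\in)\models\phi$ means that $\forall(t_1,\dots,t_k:V).[\![\phi]\!]_V(t_1,\dots,t_k)$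 is inhabited. $\mathbf{ECST}$ (Elementary Constructive Set Theory) consists of: Extensionality, Empty Set, Pairing, Union; Strong Infinity: $\exists a(\mathrm{Ind}(a)\wedge\forall b(\mathrm{Ind}(b)\Rightarrow a\subseteq b))$, where $\mathrm{Ind}(x):=(\emptyset\in x\wedge\forall y\in x\; y\cup\{y\}\in x)$; $\Delta_0$-Separation: $\forall a\exists w\forall x(x\in w\iff x\in a\wedge\phi(x))$ for every $\Delta_0$ formula $\phi$ (all quantifiers bounded, of the form $\forall x\in y$ or $\exists x\in y$); and the Replacement scheme: $\forall S(\forall x\exists!y\,\phi(x,y)\Rightarrow\exists w\forall v(v\in w\iff\exists u\in S\,\phi(u,v)))$ for every formula $\phi$. In the schemes, $\phi$ may have further free variables as parameters. *)

(* Defs.v *)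
From Stdlib Require Import List Arith.
Import ListNotations.

(** "HoTT proves ..." is a statement about derivability, so the type theory is
    represented by its raw syntax and its typing rules.  (Taking Rocq's own
    types as the types of HoTT, with univalence as a hypothesis, would not do:
    that hypothesis is refutable from proof irrelevance, and Rocq's [Prop] and
    axioms would be available besides.)

    The system is presented in the style of the first presentation in the
    appendix of the HoTT Book: a lambda calculus with dependent products and a
    cumulative tower of universes, an untyped convertibility relation, and
    primitive constants with closed types and defining equations. *)

(** * Raw syntax *)

(** The parameters of a constant are universe levels.  In eliminators the last
    level is that of the motive. *)
Inductive const : Type :=
| cEmpty | cIndEmpty (k : nat)
| cUnit | cTt | cIndUnit (k : nat)
| cSum (i : nat) | cInl (i : nat) | cInr (i : nat) | cIndSum (i k : nat)
| cSig (i : nat) | cPair (i : nat) | cIndSig (i k : nat)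
| cNat | cZero | cSucc | cIndNat (k : nat)
| cW (i : nat) | cSup (i : nat) | cIndW (i k : nat)
| cId (i : nat) | cRefl (i : nat) | cIndId (i k : nat)
| cFunext (i : nat) | cUnivalence (i : nat)
| cTr (i : nat) | cTrIn (i : nat) | cTrPath (i : nat) | cIndTr (i k : nat)
| cQuo (i : nat) | cQuoIn (i : nat) | cQuoPath (i : nat) | cQuoSet (i : nat)
| cIndQuo (i k : nat)
| cV (i : nat) | cSet (i : nat) | cSetExt (i : nat) | cVSet (i : nat)
| cIndV (i k : nat).

(** Variables are de Bruijn indices. *)
Inductive tm : Type :=
| Var (n : nat)
| Univ (i : nat)
| Cst (c : const)
| Pi (A B : tm)
| Lam (A b : tm)
| App (f a : tm).

Definition upren (r : nat -> nat) (n : nat) : nat :=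
  match n with 0 => 0 | S m => S (r m) end.

Fixpoint ren (r : nat -> nat) (t : tm) : tm :=
  match t with
  | Var n => Var (r n)
  | Univ i => Univ i
  | Cst c => Cst c
  | Pi A B => Pi (ren r A) (ren (upren r) B)
  | Lam A b => Lam (ren r A) (ren (upren r) b)
  | App f a => App (ren r f) (ren r a)
  end.

Definition lift (t : tm) : tm := ren S t.

Definition upsub (s : nat -> tm) (n : nat) : tm :=
  match n with 0 => Var 0 | S m => lift (s m) end.

Fixpoint subst (s : nat -> tm) (t : tm) : tm :=
  match t with
  | Var n => s n
  | Univ i => Univ i
  | Cst c => Cst c
  | Pi A B => Pi (subst s A) (subst (upsub s) B)
  | Lam A b => Lam (subst s A) (subst (upsub s) b)
  | App f a => App (subst s f) (subst s a)
  end.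

(** [subst1 a t] replaces variable 0 of [t] by [a]. *)
Definition subst1 (a t : tm) : tm :=
  subst (fun n => match n with 0 => a | S m => Var m end) t.

Definition apps (f : tm) (l : list tm) : tm := fold_left App l f.

(** * Writing terms with named variables *)

(** An [stm] is a term awaiting the number of binders above it; a bound variable
    remembers its own binding depth and computes its index at each occurrence,
    so that placing an [stm] under further binders weakens it. *)
Definition stm : Type := nat -> tm.
Definition closed_tm (t : stm) : tm := t 0.

Definition sVar (d : nat) : stm := fun n => Var (n - S d).
Definition sCst (c : const) : stm := fun _ => Cst c.
Definition sPi (A : stm) (B : stm -> stm) : stm :=
  fun n => Pi (A n) (B (sVar n) (S n)).
Definition sLam (A : stm) (b : stm -> stm) : stm :=
  fun n => Lam (A n) (b (sVar n) (S n)).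
Definition sApp (f a : stm) : stm := fun n => App (f n) (a n).
Definition U (i : nat) : stm := fun _ => Univ i.

Coercion sCst : const >-> stm.

Declare Scope hott_scope.
Delimit Scope hott_scope with hott.
Bind Scope hott_scope with stm.
Notation "'Π' x : A , B" := (sPi A (fun x => B))
  (at level 200, x name, A at level 99, B at level 200) : hott_scope.
Notation "'λ' x : A , b" := (sLam A (fun x => b))
  (at level 200, x name, A at level 99, b at level 200) : hott_scope.
Notation "A ~> B" := (sPi A (fun _ => B))
  (at level 55, right associativity) : hott_scope.
Notation "f @ a" := (sApp f a) (at level 20, left associativity) : hott_scope.
Local Open Scope hott_scope.

(** * Notions used in the types of the constants *)

Definition sig (i : nat) (A : stm) (B : stm -> stm) : stm :=
  cSig i @ A @ (λ x : A, B x).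
Definition prod (i : nat) (A B : stm) : stm := sig i A (fun _ => B).
Definition pair (i : nat) (A : stm) (B : stm -> stm) (a b : stm) : stm :=
  cPair i @ A @ (λ x : A, B x) @ a @ b.
Definition pr1 (i : nat) (A : stm) (B : stm -> stm) (u : stm) : stm :=
  cIndSig i i @ A @ (λ x : A, B x) @ (λ _ : sig i A B, A)
    @ (λ x : A, λ _ : B x, x) @ u.
Definition pr2 (i : nat) (A : stm) (B : stm -> stm) (u : stm) : stm :=
  cIndSig i i @ A @ (λ x : A, B x) @ (λ v : sig i A B, B (pr1 i A B v))
    @ (λ x : A, λ y : B x, y) @ u.

Definition tId (i : nat) (A x y : stm) : stm := cId i @ A @ x @ y.
Definition isProp (i : nat) (A : stm) : stm := Π x : A, Π y : A, tId i A x y.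
Definition isSet (i : nat) (A : stm) : stm :=
  Π x : A, Π y : A, isProp i (tId i A x y).

Definition transport (i k : nat) (A P x y p u : stm) : stm :=
  cIndId i k @ A
    @ (λ a : A, λ b : A, λ _ : tId i A a b, P @ a ~> P @ b)
    @ (λ a : A, λ v : P @ a, v) @ x @ y @ p @ u.
Definition pathover (i k : nat) (A P x y p u v : stm) : stm :=
  tId k (P @ y) (transport i k A P x y p u) v.

(** Bi-invertible maps. *)
Definition linv (i : nat) (A B f : stm) : stm :=
  sig i (B ~> A) (fun h => Π a : A, tId i A (h @ (f @ a)) a).
Definition rinv (i : nat) (A B f : stm) : stm :=
  sig i (B ~> A) (fun g => Π b : B, tId i B (f @ (g @ b)) b).
Definition isequiv (i : nat) (A B f : stm) : stm :=
  prod i (rinv i A B f) (linv i A B f).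
Definition equiv (i : nat) (A B : stm) : stm :=
  sig i (A ~> B) (fun f => isequiv i A B f).

Definition idfun (A : stm) : stm := λ x : A, x.
Definition idequiv (i : nat) (A : stm) : stm :=
  let inverse := pair i (A ~> A) (fun g => Π a : A, tId i A (g @ a) a)
                   (idfun A) (λ a : A, cRefl i @ A @ a) in
  pair i (A ~> A) (fun f => isequiv i A A f) (idfun A)
    (pair i (rinv i A A (idfun A)) (fun _ => linv i A A (idfun A))
       inverse inverse).
Definition idtoeqv (i : nat) (A B : stm) : stm :=
  λ p : tId (S i) (U i) A B,
    cIndId (S i) i @ U i
      @ (λ X : U i, λ Y : U i, λ _ : tId (S i) (U i) X Y, equiv i X Y)
      @ (λ X : U i, idequiv i X) @ A @ B @ p.
Definition happly (i : nat) (A B f g : stm) : stm :=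
  λ p : tId i (Π x : A, B @ x) f g,
    cIndId i i @ (Π x : A, B @ x)
      @ (λ f' : (Π x : A, B @ x), λ g' : (Π x : A, B @ x),
         λ _ : tId i (Π x : A, B @ x) f' g',
           Π x : A, tId i (B @ x) (f' @ x) (g' @ x))
      @ (λ f' : (Π x : A, B @ x), λ x : A, cRefl i @ (B @ x) @ (f' @ x))
      @ f @ g @ p.

(** Mere existence, and the clause of the equality constructor of [V]. *)
Definition ex (i : nat) (A : stm) (B : stm -> stm) : stm := cTr i @ sig i A B.
Definition bitotal (i : nat) (A B : stm) (R : stm -> stm -> stm) : stm :=
  prod i (Π a : A, ex i B (fun b => R a b)) (Π b : B, ex i A (fun a => R a b)).

(** * Types of the constants *)

Definition const_stm (c : const) : stm :=
  match c with
  | cEmpty => U 0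
  | cIndEmpty k => Π C : cEmpty ~> U k, Π x : cEmpty, C @ x
  | cUnit => U 0
  | cTt => cUnit
  | cIndUnit k => Π C : cUnit ~> U k, C @ cTt ~> Π x : cUnit, C @ x
  | cSum i => U i ~> U i ~> U i
  | cInl i => Π A : U i, Π B : U i, A ~> cSum i @ A @ B
  | cInr i => Π A : U i, Π B : U i, B ~> cSum i @ A @ B
  | cIndSum i k =>
      Π A : U i, Π B : U i, Π C : cSum i @ A @ B ~> U k,
      (Π a : A, C @ (cInl i @ A @ B @ a)) ~>
      (Π b : B, C @ (cInr i @ A @ B @ b)) ~>
      Π x : cSum i @ A @ B, C @ x
  | cSig i => Π A : U i, (A ~> U i) ~> U i
  | cPair i => Π A : U i, Π B : A ~> U i, Π a : A, B @ a ~> cSig i @ A @ B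
  | cIndSig i k =>
      Π A : U i, Π B : A ~> U i, Π C : cSig i @ A @ B ~> U k,
      (Π a : A, Π b : B @ a, C @ (cPair i @ A @ B @ a @ b)) ~>
      Π x : cSig i @ A @ B, C @ x
  | cNat => U 0
  | cZero => cNat
  | cSucc => cNat ~> cNat
  | cIndNat k =>
      Π C : cNat ~> U k, C @ cZero ~>
      (Π n : cNat, C @ n ~> C @ (cSucc @ n)) ~> Π n : cNat, C @ n
  | cW i => Π A : U i, (A ~> U i) ~> U i
  | cSup i =>
      Π A : U i, Π B : A ~> U i, Π a : A,
      (B @ a ~> cW i @ A @ B) ~> cW i @ A @ B
  | cIndW i k =>
      Π A : U i, Π B : A ~> U i, Π C : cW i @ A @ B ~> U k,
      (Π a : A, Π f : B @ a ~> cW i @ A @ B,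
         (Π b : B @ a, C @ (f @ b)) ~> C @ (cSup i @ A @ B @ a @ f)) ~>
      Π w : cW i @ A @ B, C @ w
  | cId i => Π A : U i, A ~> A ~> U i
  | cRefl i => Π A : U i, Π a : A, tId i A a a
  | cIndId i k =>
      Π A : U i, Π C : (Π x : A, Π y : A, tId i A x y ~> U k),
      (Π x : A, C @ x @ x @ (cRefl i @ A @ x)) ~>
      Π x : A, Π y : A, Π p : tId i A x y, C @ x @ y @ p
  | cFunext i =>
      Π A : U i, Π B : A ~> U i,
      Π f : (Π x : A, B @ x), Π g : (Π x : A, B @ x),
      isequiv i (tId i (Π x : A, B @ x) f g)
        (Π x : A, tId i (B @ x) (f @ x) (g @ x)) (happly i A B f g)
  | cUnivalence i =>
      Π A : U i, Π B : U i,
      isequiv (S i) (tId (S i) (U i) A B) (equiv i A B) (idtoeqv i A B)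
  (* propositional truncation *)
  | cTr i => U i ~> U i
  | cTrIn i => Π A : U i, A ~> cTr i @ A
  | cTrPath i => Π A : U i, isProp i (cTr i @ A)
  | cIndTr i k =>
      Π A : U i, Π C : cTr i @ A ~> U k,
      (Π a : A, C @ (cTrIn i @ A @ a)) ~>
      (Π x : cTr i @ A, Π y : cTr i @ A, Π u : C @ x, Π v : C @ y,
         pathover i k (cTr i @ A) C x y (cTrPath i @ A @ x @ y) u v) ~>
      Π x : cTr i @ A, C @ x
  (* set quotient *)
  | cQuo i => Π A : U i, (A ~> A ~> U i) ~> U i
  | cQuoIn i => Π A : U i, Π R : A ~> A ~> U i, A ~> cQuo i @ A @ R
  | cQuoPath i =>
      Π A : U i, Π R : A ~> A ~> U i, Π a : A, Π b : A, R @ a @ b ~>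
      tId i (cQuo i @ A @ R) (cQuoIn i @ A @ R @ a) (cQuoIn i @ A @ R @ b)
  | cQuoSet i => Π A : U i, Π R : A ~> A ~> U i, isSet i (cQuo i @ A @ R)
  | cIndQuo i k =>
      Π A : U i, Π R : A ~> A ~> U i, Π C : cQuo i @ A @ R ~> U k,
      (Π x : cQuo i @ A @ R, isSet k (C @ x)) ~>
      Π q : (Π a : A, C @ (cQuoIn i @ A @ R @ a)),
      (Π a : A, Π b : A, Π r : R @ a @ b,
         pathover i k (cQuo i @ A @ R) C
           (cQuoIn i @ A @ R @ a) (cQuoIn i @ A @ R @ b)
           (cQuoPath i @ A @ R @ a @ b @ r) (q @ a) (q @ b)) ~>
      Π x : cQuo i @ A @ R, C @ x
  (* cumulative hierarchy over [U i], a type in [U (S i)] *)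
  | cV i => U (S i)
  | cSet i => Π A : U i, (A ~> cV i) ~> cV i
  | cSetExt i =>
      Π A : U i, Π B : U i, Π f : A ~> cV i, Π g : B ~> cV i,
      bitotal (S i) A B (fun a b => tId (S i) (cV i) (f @ a) (g @ b)) ~>
      tId (S i) (cV i) (cSet i @ A @ f) (cSet i @ B @ g)
  | cVSet i => isSet (S i) (cV i)
  | cIndV i k =>
      let m := Nat.max (S i) k in
      Π P : cV i ~> U k,
      (Π x : cV i, isSet k (P @ x)) ~>
      Π c : (Π A : U i, Π f : A ~> cV i,
               (Π a : A, P @ (f @ a)) ~> P @ (cSet i @ A @ f)),
      (Π A : U i, Π B : U i, Π f : A ~> cV i, Π g : B ~> cV i,
       Π e : bitotal (S i) A B (fun a b => tId (S i) (cV i) (f @ a) (g @ b)),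
       Π h : (Π a : A, P @ (f @ a)), Π l : (Π b : B, P @ (g @ b)),
         bitotal m A B (fun a b =>
           ex m (tId (S i) (cV i) (f @ a) (g @ b)) (fun p =>
             pathover (S i) k (cV i) P (f @ a) (g @ b) p (h @ a) (l @ b))) ~>
         pathover (S i) k (cV i) P (cSet i @ A @ f) (cSet i @ B @ g)
           (cSetExt i @ A @ B @ f @ g @ e) (c @ A @ f @ h) (c @ B @ g @ l)) ~>
      Π x : cV i, P @ x
  end.

Definition const_type (c : const) : tm := closed_tm (const_stm c).

(** * Convertibility *)

(** Defining equations of the eliminators.  The parameters of a constructor are
    primed because they are not compared with those of the eliminator; in a
    well-typed term they are convertible.  As in the HoTT Book, eliminators of
    higher inductive types compute judgmentally on point constructors.  There
    are no equations for path constructors: the motives of [cIndTr], [cIndQuo]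
    and [cIndV] are families of h-sets, where such equations hold anyway. *)
Inductive iota : tm -> tm -> Prop :=
| iota_unit k C c :
    iota (apps (Cst (cIndUnit k)) [C; c; Cst cTt]) c
| iota_inl i k A B C f g A' B' a :
    iota (apps (Cst (cIndSum i k)) [A; B; C; f; g; apps (Cst (cInl i)) [A'; B'; a]])
         (App f a)
| iota_inr i k A B C f g A' B' b :
    iota (apps (Cst (cIndSum i k)) [A; B; C; f; g; apps (Cst (cInr i)) [A'; B'; b]])
         (App g b)
| iota_sig i k A B C f A' B' a b :
    iota (apps (Cst (cIndSig i k)) [A; B; C; f; apps (Cst (cPair i)) [A'; B'; a; b]])
         (apps f [a; b])
| iota_zero k C z s :
    iota (apps (Cst (cIndNat k)) [C; z; s; Cst cZero]) z
| iota_succ k C z s n :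
    iota (apps (Cst (cIndNat k)) [C; z; s; App (Cst cSucc) n])
         (apps s [n; apps (Cst (cIndNat k)) [C; z; s; n]])
| iota_sup i k A B C s A' B' a f :
    iota (apps (Cst (cIndW i k)) [A; B; C; s; apps (Cst (cSup i)) [A'; B'; a; f]])
         (apps s [a; f;
            Lam (App B a)
              (apps (Cst (cIndW i k))
                 [lift A; lift B; lift C; lift s; App (lift f) (Var 0)])])
| iota_refl i k A C c x y A' a :
    iota (apps (Cst (cIndId i k)) [A; C; c; x; y; apps (Cst (cRefl i)) [A'; a]])
         (App c a)
| iota_tr i k A C f h A' a :
    iota (apps (Cst (cIndTr i k)) [A; C; f; h; apps (Cst (cTrIn i)) [A'; a]])
         (App f a)
| iota_quo i k A R C h q r A' R' a :
    iota (apps (Cst (cIndQuo i k))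
            [A; R; C; h; q; r; apps (Cst (cQuoIn i)) [A'; R'; a]])
         (App q a)
| iota_set i k P h c r A f :
    iota (apps (Cst (cIndV i k)) [P; h; c; r; apps (Cst (cSet i)) [A; f]])
         (apps c [A; f;
            Lam A
              (apps (Cst (cIndV i k))
                 [lift P; lift h; lift c; lift r; App (lift f) (Var 0)])]).

Inductive conv : tm -> tm -> Prop :=
| conv_refl t : conv t t
| conv_sym t u : conv t u -> conv u t
| conv_trans t u v : conv t u -> conv u v -> conv t v
| conv_pi A A' B B' : conv A A' -> conv B B' -> conv (Pi A B) (Pi A' B')
| conv_lam A A' b b' : conv A A' -> conv b b' -> conv (Lam A b) (Lam A' b')
| conv_app f f' a a' : conv f f' -> conv a a' -> conv (App f a) (App f' a')
| conv_beta A b a : conv (App (Lam A b) a) (subst1 a b)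
| conv_eta A f : conv (Lam A (App (lift f) (Var 0))) f
| conv_iota t u : iota t u -> conv t u.

(** * Typing *)

(** There is no judgment for well-formed contexts: only the empty context occurs
    below, and in a derivation from it every extension is by a checked type. *)
Inductive has_type : list tm -> tm -> tm -> Prop :=
| T_var Γ n A :
    nth_error Γ n = Some A -> has_type Γ (Var n) (ren (fun m => S n + m) A)
| T_univ Γ i : has_type Γ (Univ i) (Univ (S i))
| T_cumul Γ A i : has_type Γ A (Univ i) -> has_type Γ A (Univ (S i))
| T_cst Γ c : has_type Γ (Cst c) (const_type c)
| T_pi Γ A B i :
    has_type Γ A (Univ i) -> has_type (A :: Γ) B (Univ i) ->
    has_type Γ (Pi A B) (Univ i)
| T_lam Γ A B b i :
    has_type Γ A (Univ i) -> has_type (A :: Γ) b B ->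
    has_type Γ (Lam A b) (Pi A B)
| T_app Γ A B f a :
    has_type Γ f (Pi A B) -> has_type Γ a A -> has_type Γ (App f a) (subst1 a B)
| T_conv Γ A B t i :
    has_type Γ t A -> conv A B -> has_type Γ B (Univ i) -> has_type Γ t B.

Definition inhabited_in_HoTT (A : stm) : Prop :=
  exists t : tm, has_type [] t (closed_tm A).

(** * Membership *)

(** Membership is defined by recursion on its second argument, with values in
    the type of propositions of [U (S i)].  The recursor of [V] asks for proofs
    that this type is a set and that the clause for [set A f] respects the
    equality constructor; the terms leading up to [mem] provide these proofs.
    Their types are indicated in comments. *)

Definition refl (i : nat) (A x : stm) : stm := cRefl i @ A @ x.
Definition inv (i : nat) (A x y p : stm) : stm :=
  cIndId i i @ A @ (λ a : A, λ b : A, λ _ : tId i A a b, tId i A b a)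
    @ (λ a : A, refl i A a) @ x @ y @ p.
Definition concat (i : nat) (A x y z p q : stm) : stm :=
  transport i i A (λ w : A, tId i A x w) y z q p.
Definition ap (i k : nat) (A B : stm) (f : stm -> stm) (x y p : stm) : stm :=
  cIndId i k @ A
    @ (λ a : A, λ b : A, λ _ : tId i A a b, tId k B (f a) (f b))
    @ (λ a : A, refl k B (f a)) @ x @ y @ p.

(* Π x y (p : x = y), p^-1 · p = refl *)
Definition inv_concat (i : nat) (A : stm) : stm :=
  cIndId i i @ A
    @ (λ x : A, λ y : A, λ p : tId i A x y,
         tId i (tId i A y y) (concat i A y x y (inv i A x y p) p) (refl i A y))
    @ (λ x : A, refl i (tId i A x x) (refl i A x)).

(* If R is a reflexive family of propositions on A that implies identity, then
   A is a set:
     (Π x y, isProp (R x y)) -> (Π x, R x x) -> (Π x y, R x y -> x = y) ->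
     isSet A *)
Definition set_of_rel (i : nat) : stm :=
  λ A : U i, λ R : A ~> A ~> U i,
  λ hR : (Π x : A, Π y : A, isProp i (R @ x @ y)),
  λ r : (Π x : A, R @ x @ x),
  λ g : (Π x : A, Π y : A, R @ x @ y ~> tId i A x y),
  let toR x y p := transport i i A (R @ x) x y p (r @ x) in
  let ofR x y s :=
    concat i A x x y (inv i A x x (g @ x @ x @ (r @ x))) (g @ x @ y @ s) in
  let retr x y p :=
    cIndId i i @ A
      @ (λ x : A, λ y : A, λ p : tId i A x y,
           tId i (tId i A x y) (ofR x y (toR x y p)) p)
      @ (λ x : A, inv_concat i A @ x @ x @ (g @ x @ x @ (r @ x)))
      @ x @ y @ p in
  λ x : A, λ y : A, λ p : tId i A x y, λ q : tId i A x y,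
  let X := tId i A x y in
  let p' := ofR x y (toR x y p) in
  let q' := ofR x y (toR x y q) in
  concat i X p p' q (inv i X p' p (retr x y p))
    (concat i X p' q' q
       (ap i i (R @ x @ y) X (fun s => ofR x y s) (toR x y p) (toR x y q)
          (hR @ x @ y @ toR x y p @ toR x y q))
       (retr x y q)).

(* Π A, isProp A -> isSet A *)
Definition set_of_prop (i : nat) : stm :=
  λ A : U i, λ h : isProp i A,
  set_of_rel i @ A @ (λ _ : A, λ _ : A, cUnit)
    @ (λ _ : A, λ _ : A,
         cIndUnit i @ (λ u : cUnit, Π v : cUnit, tId i cUnit u v)
           @ (cIndUnit i @ (λ v : cUnit, tId i cUnit cTt v) @ refl i cUnit cTt))
    @ (λ _ : A, cTt)
    @ (λ x : A, λ y : A, λ _ : cUnit, h @ x @ y).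

(* (Π x, f x = g x) -> f = g *)
Definition funext (i : nat) (A B f g e : stm) : stm :=
  let X := tId i (Π x : A, B @ x) f g in
  let Y := Π x : A, tId i (B @ x) (f @ x) (g @ x) in
  let hap := happly i A B f g in
  pr1 i (Y ~> X) (fun h => Π b : Y, tId i Y (hap @ (h @ b)) b)
    (pr1 i (rinv i X Y hap) (fun _ => linv i X Y hap)
       (cFunext i @ A @ B @ f @ g)) @ e.

(* Π A, isProp (isProp A) *)
Definition isProp_isProp (i : nat) : stm :=
  λ A : U i, λ h : isProp i A, λ h' : isProp i A,
  funext i A (λ x : A, Π y : A, tId i A x y) h h'
    (λ x : A, funext i A (λ y : A, tId i A x y) (h @ x) (h' @ x)
       (λ y : A, set_of_prop i @ A @ h @ x @ y @ (h @ x @ y) @ (h' @ x @ y))).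

(* Π A B, isProp B -> isProp (A -> B) *)
Definition isProp_arrow (i : nat) : stm :=
  λ A : U i, λ B : U i, λ hB : isProp i B, λ f : A ~> B, λ g : A ~> B,
  funext i A (λ _ : A, B) f g (λ x : A, hB @ (f @ x) @ (g @ x)).

(* Π A B, isProp A -> isProp B -> isProp (A * B) *)
Definition isProp_prod (i : nat) : stm :=
  λ A : U i, λ B : U i, λ hA : isProp i A, λ hB : isProp i B,
  let AB := prod i A B in
  let pr a b := pair i A (fun _ => B) a b in
  cIndSig i i @ A @ (λ _ : A, B) @ (λ u : AB, Π v : AB, tId i AB u v)
    @ (λ a : A, λ b : B,
         cIndSig i i @ A @ (λ _ : A, B) @ (λ v : AB, tId i AB (pr a b) v)
           @ (λ a' : A, λ b' : B,
                concat i AB (pr a b) (pr a' b) (pr a' b')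
                  (ap i i A AB (fun z => pr z b) a a' (hA @ a @ a'))
                  (ap i i B AB (fun z => pr a' z) b b' (hB @ b @ b')))).

(* Π P Q, isProp P -> isProp Q -> (P -> Q) -> (Q -> P) -> P = Q *)
Definition propext (i : nat) : stm :=
  λ P : U i, λ Q : U i, λ hP : isProp i P, λ hQ : isProp i Q,
  λ f : P ~> Q, λ g : Q ~> P,
  let X := tId (S i) (U i) P Q in
  let Y := equiv i P Q in
  let F := idtoeqv i P Q in
  pr1 (S i) (Y ~> X) (fun h => Π b : Y, tId (S i) Y (F @ (h @ b)) b)
    (pr1 (S i) (rinv (S i) X Y F) (fun _ => linv (S i) X Y F)
       (cUnivalence i @ P @ Q))
  @ pair i (P ~> Q) (fun k => isequiv i P Q k) f
      (pair i (rinv i P Q f) (fun _ => linv i P Q f)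
         (pair i (Q ~> P) (fun k => Π b : Q, tId i Q (f @ (k @ b)) b)
            g (λ b : Q, hQ @ (f @ (g @ b)) @ b))
         (pair i (Q ~> P) (fun k => Π a : P, tId i P (k @ (f @ a)) a)
            g (λ a : P, hP @ (g @ (f @ a)) @ a))).

(** The type of propositions of [U i], in [U (S i)]. *)
Definition hProp (i : nat) : stm := sig (S i) (U i) (fun P => isProp i P).
Definition mkProp (i : nat) (P hP : stm) : stm :=
  pair (S i) (U i) (fun P => isProp i P) P hP.
Definition holds (i : nat) (X : stm) : stm :=
  pr1 (S i) (U i) (fun P => isProp i P) X.
Definition holds_isProp (i : nat) (X : stm) : stm :=
  pr2 (S i) (U i) (fun P => isProp i P) X.

(* Π X Y : hProp, (X -> Y) * (Y -> X) -> X = Y *)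
Definition hProp_ext (i : nat) : stm :=
  let H := hProp i in
  let iff P Q := prod i (P ~> Q) (Q ~> P) in
  let samefst :=
    cIndId (S i) (S i) @ U i
      @ (λ P : U i, λ Q : U i, λ _ : tId (S i) (U i) P Q,
           Π hP : isProp i P, Π hQ : isProp i Q,
           tId (S i) H (mkProp i P hP) (mkProp i Q hQ))
      @ (λ P : U i, λ hP : isProp i P, λ hP' : isProp i P,
           ap i (S i) (isProp i P) H (fun h => mkProp i P h) hP hP'
             (isProp_isProp i @ P @ hP @ hP')) in
  cIndSig (S i) (S i) @ U i @ (λ P : U i, isProp i P)
    @ (λ X : H, Π Y : H, iff (holds i X) (holds i Y) ~> tId (S i) H X Y)
    @ (λ P : U i, λ hP : isProp i P,
       cIndSig (S i) (S i) @ U i @ (λ Q : U i, isProp i Q)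
         @ (λ Y : H, iff P (holds i Y) ~> tId (S i) H (mkProp i P hP) Y)
         @ (λ Q : U i, λ hQ : isProp i Q, λ s : iff P Q,
              samefst @ P @ Q
                @ (propext i @ P @ Q @ hP @ hQ
                     @ pr1 i (P ~> Q) (fun _ => Q ~> P) s
                     @ pr2 i (P ~> Q) (fun _ => Q ~> P) s)
                @ hP @ hQ)).

(* isSet hProp.  The [ap] along the identity turns an identification at level [i]
   into one at level [S i]. *)
Definition isSet_hProp (i : nat) : stm :=
  let H := hProp i in
  let T X := holds i X in
  set_of_rel (S i) @ H
    @ (λ X : H, λ Y : H, prod i (T X ~> T Y) (T Y ~> T X))
    @ (λ X : H, λ Y : H,
         λ s : prod i (T X ~> T Y) (T Y ~> T X),
         λ t : prod i (T X ~> T Y) (T Y ~> T X),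
         ap i (S i) (prod i (T X ~> T Y) (T Y ~> T X))
           (prod i (T X ~> T Y) (T Y ~> T X)) (fun z => z) s t
           (isProp_prod i @ (T X ~> T Y) @ (T Y ~> T X)
              @ (isProp_arrow i @ T X @ T Y @ holds_isProp i Y)
              @ (isProp_arrow i @ T Y @ T X @ holds_isProp i X) @ s @ t))
    @ (λ X : H, pair i (T X ~> T X) (fun _ => T X ~> T X)
                  (idfun (T X)) (idfun (T X)))
    @ hProp_ext i.

(* [trbind i A B f : Tr A -> Tr B] extends [f : A -> Tr B]. *)
Definition trbind (i : nat) (A B f : stm) : stm :=
  cIndTr i i @ A @ (λ _ : cTr i @ A, cTr i @ B) @ f
    @ (λ x : cTr i @ A, λ y : cTr i @ A,
       λ u : cTr i @ B, λ v : cTr i @ B,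
       cTrPath i @ B
         @ transport i i (cTr i @ A) (λ _ : cTr i @ A, cTr i @ B) x y
             (cTrPath i @ A @ x @ y) u
         @ v).

(* Π x y (p : x = y) u, transport (fun _ => C) p u = u *)
Definition transport_const (i k : nat) (A C : stm) : stm :=
  cIndId i k @ A
    @ (λ x : A, λ y : A, λ p : tId i A x y, Π u : C,
         tId k C (transport i k A (λ _ : A, C) x y p u) u)
    @ (λ x : A, λ u : C, refl k C u).

(* The clause [x ∈ set A f := exists a, x = f a]. *)
Definition mem_clause (i : nat) (x A f : stm) : stm :=
  ex (S i) A (fun a => tId (S i) (cV i) x (f @ a)).

(* From [Π a, exists b, R a b] and [Π a b, R a b -> f a = g b]:
   x ∈ set A f -> x ∈ set B g *)
Definition mem_map (i : nat) (x A B f g : stm) (R : stm -> stm -> stm)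
    (e : stm) (path : stm -> stm -> stm -> stm) : stm :=
  let j := S i in
  let E := tId j (cV i) in
  let SA := sig j A (fun a => E x (f @ a)) in
  let SB := sig j B (fun b => E x (g @ b)) in
  trbind j SA SB
    (cIndSig j j @ A @ (λ a : A, E x (f @ a)) @ (λ _ : SA, cTr j @ SB)
       @ (λ a : A, λ p : E x (f @ a),
          trbind j (sig j B (fun b => R a b)) SB
            (cIndSig j j @ B @ (λ b : B, R a b)
               @ (λ _ : sig j B (fun b => R a b), cTr j @ SB)
               @ (λ b : B, λ q : R a b,
                    cTrIn j @ SB
                      @ pair j B (fun b => E x (g @ b)) b
                          (concat j (cV i) x (f @ a) (g @ b) p (path a b q))))
            @ (e @ a))).

(** [mem i @ x @ y] is the proposition "x is a member of y". *)
Definition mem (i : nat) : stm :=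
  let j := S i in
  let V : stm := cV i in
  let H := hProp j in
  let inProp x A f :=
    mkProp j (mem_clause i x A f)
      (cTrPath j @ sig j A (fun a => tId j V x (f @ a))) in
  let E f g a b := tId j V (f @ a) (g @ b) in
  λ x : V, λ y : V,
  holds j
    (cIndV i (S j) @ (λ _ : V, H) @ (λ _ : V, isSet_hProp j)
       @ (λ A : U i, λ f : A ~> V, λ _ : A ~> H, inProp x A f)
       @ (λ A : U i, λ B : U i, λ f : A ~> V, λ g : B ~> V,
          λ e : bitotal j A B (E f g), λ h : A ~> H, λ l : B ~> H,
          λ _ : bitotal (S j) A B (fun a b =>
                  ex (S j) (E f g a b) (fun p =>
                    pathover j (S j) V (λ _ : V, H) (f @ a) (g @ b) p
                      (h @ a) (l @ b))),
          let all1 := Π a : A, ex j B (fun b => E f g a b) in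
          let all2 := Π b : B, ex j A (fun a => E f g a b) in
          let P := mem_clause i x A f in
          let Q := mem_clause i x B g in
          concat (S j) H
            (transport j (S j) V (λ _ : V, H) (cSet i @ A @ f) (cSet i @ B @ g)
               (cSetExt i @ A @ B @ f @ g @ e) (inProp x A f))
            (inProp x A f) (inProp x B g)
            (transport_const j (S j) V H @ (cSet i @ A @ f) @ (cSet i @ B @ g)
               @ (cSetExt i @ A @ B @ f @ g @ e) @ inProp x A f)
            (hProp_ext j @ inProp x A f @ inProp x B g
               @ pair j (P ~> Q) (fun _ => Q ~> P)
                   (mem_map i x A B f g (fun a b => E f g a b)
                      (pr1 j all1 (fun _ => all2) e)
                      (fun a b q => q))
                   (mem_map i x B A g f (fun b a => E f g a b)
                      (pr2 j all1 (fun _ => all2) e)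
                      (fun b a q => inv j V (f @ a) (g @ b) q))))
       @ y).

(** * Set theory *)

(** Formulas of the language of set theory; variables are de Bruijn indices. *)
Inductive formula : Type :=
| FEq (x y : nat)
| FMem (x y : nat)
| FNot (p : formula)
| FImp (p q : formula)
| FAnd (p q : formula)
| FOr (p q : formula)
| FAll (p : formula)
| FEx (p : formula).

Fixpoint fren (r : nat -> nat) (p : formula) : formula :=
  match p with
  | FEq x y => FEq (r x) (r y)
  | FMem x y => FMem (r x) (r y)
  | FNot p => FNot (fren r p)
  | FImp p q => FImp (fren r p) (fren r q)
  | FAnd p q => FAnd (fren r p) (fren r q)
  | FOr p q => FOr (fren r p) (fren r q)
  | FAll p => FAll (fren (upren r) p)
  | FEx p => FEx (fren (upren r) p)
  end.

(** All free variables of [p] are below [fv p]. *)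
Fixpoint fv (p : formula) : nat :=
  match p with
  | FEq x y | FMem x y => Nat.max (S x) (S y)
  | FNot p => fv p
  | FImp p q | FAnd p q | FOr p q => Nat.max (fv p) (fv q)
  | FAll p | FEx p => Nat.pred (fv p)
  end.

Definition closure (p : formula) : formula := Nat.iter (fv p) FAll p.

Definition scons (x : stm) (e : nat -> stm) (n : nat) : stm :=
  match n with 0 => x | S m => e m end.

(** The (underlying type of the) proposition expressed by a formula when its free
    variables are interpreted by [e]. *)
Fixpoint interp (i : nat) (p : formula) (e : nat -> stm) : stm :=
  match p with
  | FEq x y => tId (S i) (cV i) (e x) (e y)
  | FMem x y => mem i @ e x @ e y
  | FNot p => interp i p e ~> cEmpty
  | FImp p q => interp i p e ~> interp i q e
  | FAnd p q => prod (S i) (interp i p e) (interp i q e)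
  | FOr p q => cTr (S i) @ (cSum (S i) @ interp i p e @ interp i q e)
  | FAll p => Π x : cV i, interp i p (scons x e)
  | FEx p => ex (S i) (cV i) (fun x => interp i p (scons x e))
  end.

(** HoTT proves that [(V, ∈)], with [V] built over [U i], satisfies [p].  The
    closure of [p] has no free variables, so the environment is immaterial. *)
Definition V_models (i : nat) (p : formula) : Prop :=
  inhabited_in_HoTT (interp i (closure p) (fun _ => U 0)).

Definition FIff (p q : formula) : formula := FAnd (FImp p q) (FImp q p).

(** [y] must be given as seen from outside the quantifier. *)
Definition FAllIn (y : nat) (p : formula) : formula :=
  FAll (FImp (FMem 0 (S y)) p).
Definition FExIn (y : nat) (p : formula) : formula :=
  FEx (FAnd (FMem 0 (S y)) p).

(** [exists! y, p], where [p] has [y] as variable 0. *)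
Definition FExUnique (p : formula) : formula :=
  FEx (FAnd p (FAll (FImp (fren (upren S) p) (FEq 0 1)))).

Inductive Delta0 : formula -> Prop :=
| D0_eq x y : Delta0 (FEq x y)
| D0_mem x y : Delta0 (FMem x y)
| D0_not p : Delta0 p -> Delta0 (FNot p)
| D0_imp p q : Delta0 p -> Delta0 q -> Delta0 (FImp p q)
| D0_and p q : Delta0 p -> Delta0 q -> Delta0 (FAnd p q)
| D0_or p q : Delta0 p -> Delta0 q -> Delta0 (FOr p q)
| D0_all y p : Delta0 p -> Delta0 (FAllIn y p)
| D0_ex y p : Delta0 p -> Delta0 (FExIn y p).

(* forall x y, (forall z, z ∈ x <-> z ∈ y) -> x = y *)
Definition ax_extensionality : formula :=
  FAll (FAll (FImp (FAll (FIff (FMem 0 2) (FMem 0 1))) (FEq 1 0))).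

(* exists x, forall y, ~ y ∈ x *)
Definition ax_empty : formula := FEx (FAll (FNot (FMem 0 1))).

(* forall a b, exists z, forall w, w ∈ z <-> w = a \/ w = b *)
Definition ax_pairing : formula :=
  FAll (FAll (FEx (FAll (FIff (FMem 0 1) (FOr (FEq 0 3) (FEq 0 2)))))).

(* forall a, exists w, forall x, x ∈ w <-> exists u ∈ a, x ∈ u *)
Definition ax_union : formula :=
  FAll (FEx (FAll (FIff (FMem 0 1) (FExIn 2 (FMem 1 0))))).

(* (exists e ∈ x, forall z, ~ z ∈ e) /\
   (forall y ∈ x, exists s ∈ x, forall z, z ∈ s <-> z ∈ y \/ z = y) *)
Definition FInd (x : nat) : formula :=
  FAnd (FExIn x (FAll (FNot (FMem 0 1))))
       (FAllIn x (FExIn (S x)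
          (FAll (FIff (FMem 0 1) (FOr (FMem 0 2) (FEq 0 2)))))).

(* exists a, Ind(a) /\ forall b, Ind(b) -> forall z, z ∈ a -> z ∈ b *)
Definition ax_strong_infinity : formula :=
  FEx (FAnd (FInd 0)
    (FAll (FImp (FInd 0) (FAll (FImp (FMem 0 2) (FMem 0 1)))))).

(** In [p], variable 0 is x and variable 1 is a; the others are parameters:
    forall a, exists w, forall x, x ∈ w <-> x ∈ a /\ p *)
Definition ax_separation (p : formula) : formula :=
  FAll (FEx (FAll (FIff (FMem 0 1) (FAnd (FMem 0 2) (fren (upren S) p))))).

(** In [p(x, y)], variable 0 is y, variable 1 is x and variable 2 is S; the others
    are parameters:
    forall S, (forall x, exists! y, p(x, y)) ->
      exists w, forall v, v ∈ w <-> exists u ∈ S, p(u, v) *)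
Definition ax_replacement (p : formula) : formula :=
  FAll (FImp
    (FAll (FExUnique p))
    (FEx (FAll (FIff (FMem 0 1)
       (FExIn 2 (fren (fun n => match n with
                                | 0 => 1
                                | 1 => 0
                                | S (S m) => S (S (S m))
                                end) p)))))).

Inductive ECST : formula -> Prop :=
| ECST_extensionality : ECST ax_extensionality
| ECST_empty : ECST ax_empty
| ECST_pairing : ECST ax_pairing
| ECST_union : ECST ax_union
| ECST_strong_infinity : ECST ax_strong_infinity
| ECST_separation p : Delta0 p -> ECST (ax_separation p)
| ECST_replacement p : ECST (ax_replacement p).

(* Main.v *)
From Stdlib Require Import List Arith Lia.
Require Import Defs.
Import ListNotations.

(** Each axiom holds in [V] by an argument inside type theory.

    Induction on [V] with a family of propositions as motive only asks for the
    case of [set A f] ([V_prop_ind]).  It yields extensionality, because the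
    equality constructor of [V] is extensionality for sets of the form
    [set A f].  Call a proposition of [U'] small if it is equivalent to one of
    [U].  By univalence being small is a proposition ([isProp_isSmall]), so
    induction on [V] applies once more and shows that [x = y] and [x ∈ y] are
    small ([small_eq], [small_mem]).  Quantifying over the members of [set A f]
    is quantifying over [A : U], so all bounded formulas are small; separation
    then forms [set (Σ a : A, Q a) f], where [Q a : U] is equivalent to the
    formula at [f a] ([comprehension]).  In replacement the hypothesis is
    unique existence, which gives a function [F : V -> V] without choice
    ([unique_choice]), and the image of [set A f] is [set A (F ∘ f)].  For
    infinity one takes the numerals, indexed by the natural numbers.

    Only union needs more: a set [f a] comes without a chosen index type, and
    one must be found for all [a : A] at once.  Every [v : V] has exactly one
    presentation [v = set T g] with [g] injective ([presentation]).  It exists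
    because, [f a = f b] being small, the quotient of [A] by this relation lies
    in [U]; it is unique by univalence ([isProp_pres]).  The union of
    [set A f] is then indexed by the sum of the chosen types.

    These arguments have to be exhibited as typed terms.  A type checker is
    proved sound for the typing relation ([checker_sound]), so that a typing
    judgment about concrete terms is established by evaluation; an elaborator,
    about which nothing needs to be proved, supplies the arguments that can be
    inferred.  The term [mem] is very large, so the lemmas are stated for a
    variable relation with the defining properties of membership and are
    instantiated at the end ([forall_mem_elim]).

    Two kinds of generality are beyond evaluation.  The universe level is
    reduced to [0]: adding a constant to all levels of a derivation gives a
    derivation ([shift_has_type]).  And in the two schemes the formula is
    arbitrary; that it denotes a proposition, and a small one if it is bounded,
    is proved by induction on it, using one closed term for each connective
    ([denot_isProp], [denot_isSmall]). *)

(** * Substitution *)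

Definition scons_sub (a : tm) (s : nat -> tm) (n : nat) : tm :=
  match n with 0 => a | S m => s m end.
Local Notation "a .: s" := (scons_sub a s) (at level 55, right associativity).

Lemma ren_ext t : forall r r', (forall n, r n = r' n) -> ren r t = ren r' t.
Proof.
  induction t; intros r r' H; cbn; f_equal; auto; apply IHt2; intros [|n]; cbn; auto.
Qed.

Lemma ren_ren t : forall r s, ren r (ren s t) = ren (fun n => r (s n)) t.
Proof.
  induction t; intros r s; cbn; f_equal; auto;
  rewrite IHt2; apply ren_ext; intros [|n]; reflexivity.
Qed.

Lemma subst_ext t : forall s s', (forall n, s n = s' n) -> subst s t = subst s' t.
Proof.
  induction t; intros s s' H; cbn; f_equal; auto; apply IHt2;
  intros [|n]; cbn; unfold lift; congruence.
Qed.

Lemma subst_ren t : forall r s, subst s (ren r t) = subst (fun n => s (r n)) t.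
Proof.
  induction t; intros r s; cbn; f_equal; auto;
  rewrite IHt2; apply subst_ext; intros [|n]; reflexivity.
Qed.

Lemma ren_subst t : forall r s, ren r (subst s t) = subst (fun n => ren r (s n)) t.
Proof.
  induction t; intros r s; cbn; f_equal; auto;
  rewrite IHt2; apply subst_ext; intros [|n]; cbn; unfold lift;
  rewrite ?ren_ren; reflexivity.
Qed.

Lemma subst_subst t : forall r s, subst r (subst s t) = subst (fun n => subst r (s n)) t.
Proof.
  induction t; intros r s; cbn; f_equal; auto;
  rewrite IHt2; apply subst_ext; intros [|n]; cbn; unfold lift;
  rewrite ?subst_ren, ?ren_subst; reflexivity.
Qed.

Lemma subst_var t : forall s, (forall n, s n = Var n) -> subst s t = t.
Proof.
  induction t; intros s H; cbn; f_equal; auto; apply IHt2;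
  intros [|n]; cbn; unfold lift; rewrite ?H; reflexivity.
Qed.

Lemma ren_as_subst t r : ren r t = subst (fun n => Var (r n)) t.
Proof.
  rewrite <- (subst_var (ren r t) Var) by reflexivity. apply subst_ren.
Qed.

Lemma subst1_upsub a s t : subst1 a (subst (upsub s) t) = subst (a .: s) t.
Proof.
  unfold subst1. rewrite subst_subst. apply subst_ext. intros [|n]; cbn; [reflexivity|].
  unfold lift. rewrite subst_ren. apply subst_var. reflexivity.
Qed.

(** Conjunction that evaluates its second argument only when needed, also under
    call by value. *)
Local Notation "a &&& b" := (if a then b else false) (at level 40, left associativity).

Fixpoint scoped (d : nat) (t : tm) : bool :=
  match t with
  | Var n => n <? d
  | Pi A B | Lam A B => scoped d A &&& scoped (S d) B
  | App A B => scoped d A &&& scoped d B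
  | _ => true
  end.

Lemma subst_scoped t : forall d s, scoped d t = true ->
  (forall n, n < d -> s n = Var n) -> subst s t = t.
Proof.
  induction t; intros d s Ht Hs; cbn [scoped subst] in *; try reflexivity;
  try (apply Bool.andb_true_iff in Ht as [H1 H2]).
  1: apply Hs, Nat.ltb_lt, Ht.
  3: f_equal; eauto.
  all: f_equal; [eauto|]; eapply IHt2; [exact H2|];
    intros [|n] Hn; cbn; [reflexivity | rewrite Hs by lia; reflexivity].
Qed.

Lemma subst_closed t s : scoped 0 t = true -> subst s t = t.
Proof. intros H. eapply subst_scoped; [exact H | lia]. Qed.

Lemma ren_closed t r : scoped 0 t = true -> ren r t = t.
Proof. intros H. rewrite ren_as_subst. apply subst_closed, H. Qed.

Lemma conv_of_eq t u : t = u -> conv t u.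
Proof. intros ->; constructor. Qed.

(** * Typing: levels, weakening, instantiation *)

Lemma has_type_level Γ A i j : i <= j -> has_type Γ A (Univ i) -> has_type Γ A (Univ j).
Proof. induction 1; intros HA; [exact HA | apply T_cumul; auto]. Qed.

(** A context grows at its end without any renaming; this suffices because only
    closed terms are ever moved to another context. *)
Lemma weaken Γ Δ t A : has_type Γ t A -> has_type (Γ ++ Δ) t A.
Proof.
  induction 1; try (econstructor; eassumption).
  apply T_var. rewrite nth_error_app1; [assumption|]. apply nth_error_Some. congruence.
Qed.

Lemma weaken_closed Γ t A : has_type [] t A -> has_type Γ t A.
Proof. apply (weaken []). Qed.

Definition inh (Γ : list tm) (A : tm) : Prop := exists t, has_type Γ t A.

(** The type of a closed term is kept in the form [subst s A] while the term is
    applied to one argument after the other; only at the end is the simultaneous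
    substitution carried out.  Then no lifted arguments have to be simplified. *)
Lemma app_inst Γ s f A B a :
  has_type Γ f (subst s (Pi A B)) -> has_type Γ a (subst s A) ->
  has_type Γ (App f a) (subst (a .: s) B).
Proof. intros Hf Ha. rewrite <- subst1_upsub. eapply T_app; eassumption. Qed.

Lemma inst_start Γ A : inh [] A -> exists t, has_type Γ t (subst Var A).
Proof.
  intros [t H]. exists t. rewrite subst_var by reflexivity. apply weaken_closed, H.
Qed.

Lemma inst_const Γ c : has_type Γ (Cst c) (subst Var (const_type c)).
Proof. rewrite subst_var by reflexivity. apply T_cst. Qed.

(** [inst H tac] applies the term typed by [H] to an argument whose typing is
    proved by [tac]. *)
Ltac inst H tac :=
  match type of H with has_type ?G ?f (subst ?s ?T) =>
    let T' := eval hnf in T in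
    match T' with Pi ?A ?B =>
      let H' := fresh in
      eassert (H' : has_type G (App f _) (subst (_ .: s) B));
      [eapply app_inst; [exact H | tac] |]; clear H; rename H' into H
    end
  end.

(** [start l] brings the term of a closed lemma [l] into the context of the goal. *)
Ltac start l :=
  let f := fresh "f" in let H := fresh "H" in
  match goal with |- inh ?Γ _ => destruct (inst_start Γ _ l) as [f H] end.

(** * Shifting universe levels *)

Definition shift_const (k : nat) (c : const) : const :=
  match c with
  | cEmpty => cEmpty | cIndEmpty l => cIndEmpty (l + k)
  | cUnit => cUnit | cTt => cTt | cIndUnit l => cIndUnit (l + k)
  | cSum i => cSum (i + k) | cInl i => cInl (i + k) | cInr i => cInr (i + k)
  | cIndSum i l => cIndSum (i + k) (l + k)
  | cSig i => cSig (i + k) | cPair i => cPair (i + k)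
  | cIndSig i l => cIndSig (i + k) (l + k)
  | cNat => cNat | cZero => cZero | cSucc => cSucc | cIndNat l => cIndNat (l + k)
  | cW i => cW (i + k) | cSup i => cSup (i + k) | cIndW i l => cIndW (i + k) (l + k)
  | cId i => cId (i + k) | cRefl i => cRefl (i + k) | cIndId i l => cIndId (i + k) (l + k)
  | cFunext i => cFunext (i + k) | cUnivalence i => cUnivalence (i + k)
  | cTr i => cTr (i + k) | cTrIn i => cTrIn (i + k) | cTrPath i => cTrPath (i + k)
  | cIndTr i l => cIndTr (i + k) (l + k)
  | cQuo i => cQuo (i + k) | cQuoIn i => cQuoIn (i + k) | cQuoPath i => cQuoPath (i + k)
  | cQuoSet i => cQuoSet (i + k) | cIndQuo i l => cIndQuo (i + k) (l + k)
  | cV i => cV (i + k) | cSet i => cSet (i + k) | cSetExt i => cSetExt (i + k)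
  | cVSet i => cVSet (i + k) | cIndV i l => cIndV (i + k) (l + k)
  end.

Fixpoint shift (k : nat) (t : tm) : tm :=
  match t with
  | Var n => Var n
  | Univ i => Univ (i + k)
  | Cst c => Cst (shift_const k c)
  | Pi A B => Pi (shift k A) (shift k B)
  | Lam A b => Lam (shift k A) (shift k b)
  | App f a => App (shift k f) (shift k a)
  end.

Lemma shift_ren k t : forall r, shift k (ren r t) = ren r (shift k t).
Proof. induction t; intros r; cbn; f_equal; auto. Qed.

Lemma shift_subst k t : forall s,
  shift k (subst s t) = subst (fun n => shift k (s n)) (shift k t).
Proof.
  induction t; intros s; cbn; f_equal; auto; rewrite IHt2; apply subst_ext;
  intros [|n]; cbn; [reflexivity | apply shift_ren | reflexivity | apply shift_ren].
Qed.

Lemma shift_subst1 k a t : shift k (subst1 a t) = subst1 (shift k a) (shift k t).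
Proof. unfold subst1. rewrite shift_subst. apply subst_ext. intros [|n]; reflexivity. Qed.

Lemma shift_iota k t u : iota t u -> iota (shift k t) (shift k u).
Proof. destruct 1; cbn; unfold lift; rewrite ?shift_ren; constructor. Qed.

Lemma shift_conv k t u : conv t u -> conv (shift k t) (shift k u).
Proof.
  induction 1; cbn; try (econstructor; eassumption).
  - rewrite shift_subst1. apply conv_beta.
  - unfold lift. rewrite shift_ren. apply conv_eta.
  - apply conv_iota, shift_iota; assumption.
Qed.

Lemma shift_const_type k c : c <> cEmpty -> c <> cUnit -> c <> cNat ->
  shift k (const_type c) = const_type (shift_const k c).
Proof.
  intros; destruct c; try reflexivity; try congruence.
  unfold const_type, closed_tm. cbn [const_stm shift_const].
  replace (Nat.max (S (i + k)) (k0 + k)) with (Nat.max (S i) k0 + k) by lia.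
  reflexivity.
Qed.

(** The three types that live in [U 0] at whatever level the others are shifted
    to are in all universes by cumulativity. *)
Lemma shift_has_type k Γ t A : has_type Γ t A ->
  has_type (map (shift k) Γ) (shift k t) (shift k A).
Proof.
  induction 1; cbn in *.
  - rewrite shift_ren. apply T_var. rewrite nth_error_map, H. reflexivity.
  - apply T_univ.
  - apply T_cumul; assumption.
  - assert (Hk : forall c, const_type c = Univ 0 ->
              has_type (map (shift k) Γ) (Cst c) (Univ k)).
    { intros c' E. apply (has_type_level _ _ 0); [lia|]. rewrite <- E. apply T_cst. }
    destruct c; try (rewrite shift_const_type by congruence; apply T_cst);
    apply Hk; reflexivity.
  - apply T_pi; assumption.
  - eapply T_lam; eassumption.
  - rewrite shift_subst1. eapply T_app; eassumption.
  - eapply T_conv; [eassumption | apply shift_conv; assumption | eassumption].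
Qed.

(** * A type checker *)

Scheme Equality for const.
Scheme Equality for tm.

Lemma tm_beq_sound t u : tm_beq t u = true -> t = u.
Proof. apply internal_tm_dec_bl. Qed.

Fixpoint spine (t : tm) (l : list tm) : tm * list tm :=
  match t with App f a => spine f (a :: l) | _ => (t, l) end.

Lemma apps_spine t l h l' : spine t l = (h, l') -> apps t l = apps h l'.
Proof.
  revert l; induction t; cbn; intros l E; try congruence. exact (IHt1 _ E).
Qed.

Lemma apps_snoc f l a : apps f (l ++ [a]) = App (apps f l) a.
Proof. apply fold_left_app. Qed.

(** A fragment of [iota]: an equation left out costs the checker completeness,
    not soundness. *)
Definition contract (c : const) (l : list tm) : option tm :=
  match c, l with
  | cIndUnit k, [C; c; s] =>
      match spine s [] with (Cst cTt, []) => Some c | _ => None end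
  | cIndSum i k, [A; B; C; f; g; s] =>
      match spine s [] with
      | (Cst (cInl j), [_; _; a]) => if i =? j then Some (App f a) else None
      | (Cst (cInr j), [_; _; b]) => if i =? j then Some (App g b) else None
      | _ => None
      end
  | cIndSig i k, [A; B; C; f; s] =>
      match spine s [] with
      | (Cst (cPair j), [_; _; a; b]) => if i =? j then Some (apps f [a; b]) else None
      | _ => None
      end
  | cIndNat k, [C; z; s; m] =>
      match spine m [] with
      | (Cst cZero, []) => Some z
      | (Cst cSucc, [n]) => Some (apps s [n; apps (Cst (cIndNat k)) [C; z; s; n]])
      | _ => None
      end
  | cIndId i k, [A; C; c; x; y; s] =>
      match spine s [] with
      | (Cst (cRefl j), [_; a]) => if i =? j then Some (App c a) else None
      | _ => None
      end
  | cIndTr i k, [A; C; f; h; s] =>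
      match spine s [] with
      | (Cst (cTrIn j), [_; a]) => if i =? j then Some (App f a) else None
      | _ => None
      end
  | cIndQuo i k, [A; R; C; h; q; r; s] =>
      match spine s [] with
      | (Cst (cQuoIn j), [_; _; a]) => if i =? j then Some (App q a) else None
      | _ => None
      end
  | cIndV i k, [P; h; c; r; s] =>
      match spine s [] with
      | (Cst (cSet j), [A; f]) =>
          if i =? j then
            Some (apps c [A; f;
                    Lam A (apps (Cst (cIndV i k))
                      [lift P; lift h; lift c; lift r; App (lift f) (Var 0)])])
          else None
      | _ => None
      end
  | _, _ => None
  end.

Lemma contract_sound c l u : contract c l = Some u -> iota (apps (Cst c) l) u.
Proof.
  unfold contract. intros H.
  destruct c; try discriminate H;
  repeat match type of H with
  | match ?l with nil => _ | cons _ _ => _ end = _ => destruct l; try discriminate H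
  end;
  match type of H with context [spine ?s []] =>
    destruct (spine s []) as [h args] eqn:E; apply apps_spine in E; cbn in E
  end;
  destruct h as [| |d| | |]; try discriminate H; destruct d; try discriminate H;
  repeat match type of H with
  | match ?l with nil => _ | cons _ _ => _ end = _ => destruct l; try discriminate H
  end;
  try (match type of H with context [?i =? ?j] => destruct (Nat.eqb_spec i j) end;
       try discriminate H); subst; injection H as <-; constructor.
Qed.

(** The number of arguments of an eliminator before the one it analyses. *)
Definition elim_arity (c : const) : nat :=
  match c with
  | cIndUnit _ => 2 | cIndNat _ => 3
  | cIndSig _ _ | cIndTr _ _ | cIndV _ _ => 4
  | cIndSum _ _ | cIndId _ _ => 5
  | cIndQuo _ _ => 6
  | _ => 0
  end.

Fixpoint whnf (n : nat) (t : tm) : tm :=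
  match n, t with
  | S n, App f a =>
      let f' := whnf n f in
      match f' with
      | Lam _ b => whnf n (subst1 a b)
      | _ =>
        match spine f' [] with
        | (Cst c, (_ :: _) as l) =>
            if elim_arity c =? length l then
              match contract c (l ++ [whnf n a]) with
              | Some u => whnf n u
              | None => App f' a
              end
            else App f' a
        | _ => App f' a
        end
      end
  | _, _ => t
  end.

Lemma whnf_sound n t : conv t (whnf n t).
Proof.
  revert t; induction n as [|n IH]; intros t; [constructor|].
  destruct t as [| | | | |f a]; try apply conv_refl. cbn [whnf].
  assert (Hf : conv (App f a) (App (whnf n f) a)) by (constructor; [apply IH | constructor]).
  assert (Hred : forall c l u, spine (whnf n f) [] = (Cst c, l) ->
    contract c (l ++ [whnf n a]) = Some u -> conv (App f a) (whnf n u)).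
  { intros c l u E Hu. apply apps_spine in E. cbn in E.
    apply contract_sound in Hu. rewrite apps_snoc, <- E in Hu.
    eapply conv_trans; [|apply IH].
    eapply conv_trans; [|apply conv_iota, Hu]. constructor; apply IH. }
  assert (Hstuck : conv (App f a)
    match spine (whnf n f) [] with
    | (Cst c, (_ :: _) as l) =>
        if elim_arity c =? length l then
          match contract c (l ++ [whnf n a]) with
          | Some u => whnf n u
          | None => App (whnf n f) a
          end
        else App (whnf n f) a
    | _ => App (whnf n f) a
    end).
  { destruct (spine (whnf n f) []) as [[| |c| | |] l] eqn:E; try exact Hf.
    destruct l as [|b l]; [exact Hf|].
    destruct (elim_arity c =? _); [|exact Hf].
    destruct (contract c _) eqn:Hu; [|exact Hf]. eapply Hred; eauto. }
  destruct (whnf n f) eqn:Ef; try exact Hstuck.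
  eapply conv_trans; [exact Hf|]. eapply conv_trans; [apply conv_beta | apply IH].
Qed.

Fixpoint convb (n : nat) (t u : tm) : bool :=
  match n with
  | 0 => false
  | S n =>
    if tm_beq t u then true else
    match whnf n t, whnf n u with
    | Pi A B, Pi A' B' => convb n A A' &&& convb n B B'
    | Lam A b, Lam A' b' => convb n A A' &&& convb n b b'
    | App f a, App f' a' => convb n f f' &&& convb n a a'
    | Lam A b, u' => convb n b (App (lift u') (Var 0))
    | t', Lam A b => convb n (App (lift t') (Var 0)) b
    | t', u' => tm_beq t' u'
    end
  end.

Lemma convb_sound n t u : convb n t u = true -> conv t u.
Proof.
  revert t u; induction n as [|n IH]; intros t u H; [discriminate|]. cbn [convb] in H.
  destruct (tm_beq t u) eqn:E; [apply tm_beq_sound in E as ->; constructor|]. clear E.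
  eapply conv_trans; [apply (whnf_sound n)|].
  eapply conv_trans; [|apply conv_sym, (whnf_sound n)].
  assert (Heta : forall A b v, convb n b (App (lift v) (Var 0)) = true -> conv (Lam A b) v).
  { intros A b v Hb. eapply conv_trans; [|apply (conv_eta A)].
    constructor; [constructor | apply IH, Hb]. }
  assert (Heta' : forall A b v, convb n (App (lift v) (Var 0)) b = true -> conv v (Lam A b)).
  { intros A b v Hb. eapply conv_trans; [apply conv_sym, (conv_eta A)|].
    constructor; [constructor | apply IH, Hb]. }
  destruct (whnf n t), (whnf n u); try (apply conv_of_eq, tm_beq_sound, H); eauto;
  match type of H with (if ?x then _ else _) = true => destruct x eqn:E; [|discriminate] end;
  first [apply conv_pi | apply conv_lam | apply conv_app]; eauto.
Qed.

(** Conversion to a type requires that type to be well formed.  Instead of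
    proving that inferred types are, the checker infers a type for the target
    of each conversion that is not a syntactic identity. *)
Fixpoint infer (n : nat) (Γ : list tm) (t : tm) : option tm :=
  match n with
  | 0 => None
  | S n =>
    match t with
    | Var k => option_map (ren (fun m => S k + m)) (nth_error Γ k)
    | Univ i => Some (Univ (S i))
    | Cst c => Some (const_type c)
    | Pi A B =>
        match infer n Γ A with
        | Some T =>
          match infer n (A :: Γ) B with
          | Some T' =>
            match whnf n T, whnf n T' with
            | Univ i, Univ j => Some (Univ (Nat.max i j))
            | _, _ => None
            end
          | None => None
          end
        | None => None
        end
    | Lam A b =>
        if istype n Γ A then option_map (Pi A) (infer n (A :: Γ) b) else None
    | App f a =>
        match infer n Γ f with
        | Some (Pi A B) => if check n Γ a A then Some (subst1 a B) else None
        | Some T =>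
            match whnf n T with
            | Pi A B =>
                if istype n Γ (Pi A B) &&& check n Γ a A then Some (subst1 a B) else None
            | _ => None
            end
        | None => None
        end
    end
  end
with istype (n : nat) (Γ : list tm) (A : tm) : bool :=
  match n with
  | 0 => false
  | S n =>
    match infer n Γ A with
    | Some T => match whnf n T with Univ _ => true | _ => false end
    | None => false
    end
  end
(* Cumulativity is limited to universes, but abstractions are checked against a
   product type, so a family of small types can be used, eta expanded, where a
   family of large ones is expected. *)
with check (n : nat) (Γ : list tm) (t A : tm) : bool :=
  match n with
  | 0 => false
  | S n =>
    match t, A with
    | Lam A1 b, Pi A2 B =>
        istype n Γ A1 &&& check n (A1 :: Γ) b B &&&
        (if tm_beq A1 A2 then true else convb n A1 A2 &&& istype n Γ (Pi A2 B))
    | _, _ =>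
        match infer n Γ t with
        | Some T =>
            if tm_beq T A then true
            else match whnf n T, A with
            | Univ i, Univ j => i <=? j
            | _, _ => convb n T A &&& istype n Γ A
            end
        | None => false
        end
    end
  end.

Lemma checker_sound n :
  (forall Γ t A, infer n Γ t = Some A -> has_type Γ t A) /\
  (forall Γ A, istype n Γ A = true -> exists i, has_type Γ A (Univ i)) /\
  (forall Γ t A, check n Γ t A = true -> has_type Γ t A).
Proof.
  induction n as [|n (IHi & IHt & IHc)]; [repeat split; discriminate|].
  assert (Huniv : forall Γ t T i, infer n Γ t = Some T -> whnf n T = Univ i ->
            has_type Γ t (Univ i)).
  { intros Γ t T i HT E. eapply T_conv; [apply IHi, HT | | apply T_univ].
    rewrite <- E. apply whnf_sound. }
  split; [|split].
  - intros Γ t A H. cbn [infer] in H. destruct t as [k|i|c|A1 B1|A1 b|f a].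
    + destruct (nth_error Γ k) eqn:E; cbn in H; [injection H as <-|discriminate].
      apply T_var, E.
    + injection H as <-. constructor.
    + injection H as <-. constructor.
    + destruct (infer n Γ A1) eqn:E1; [|discriminate].
      destruct (infer n (A1 :: Γ) B1) eqn:E2; [|discriminate].
      destruct (whnf n t) eqn:W1; try discriminate.
      destruct (whnf n t0) eqn:W2; try discriminate. injection H as <-.
      apply T_pi; (eapply has_type_level; [|eapply Huniv; eassumption]); lia.
    + destruct (istype n Γ A1) eqn:E1; [|discriminate].
      destruct (infer n (A1 :: Γ) b) eqn:E2; cbn in H; [injection H as <-|discriminate].
      destruct (IHt _ _ E1) as [i Hi]. eapply T_lam; eauto.
    + destruct (infer n Γ f) as [T|] eqn:E1; [|discriminate].
      assert (exists A1 B, has_type Γ f (Pi A1 B) /\ check n Γ a A1 = true /\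
                A = subst1 a B) as (A1 & B & Hf & Ha & ->).
      { apply IHi in E1.
        assert (Hred : forall A1 B, whnf n T = Pi A1 B -> istype n Γ (Pi A1 B) = true ->
                  has_type Γ f (Pi A1 B)).
        { intros A1 B W Hty. destruct (IHt _ _ Hty) as [i Hi].
          eapply T_conv; [exact E1| |exact Hi]. rewrite <- W. apply whnf_sound. }
        destruct T;
        repeat match type of H with
        | match ?x with _ => _ end = _ => destruct x eqn:?; try discriminate H
        end; injection H as <-;
        try match goal with E : (_ &&& _) = true |- _ =>
          apply Bool.andb_true_iff in E as [? ?] end; eauto 8. }
      eapply T_app; eauto.
  - intros Γ A H. cbn [istype] in H. destruct (infer n Γ A) eqn:E; [|discriminate].
    destruct (whnf n t) eqn:W; try discriminate. eauto.
  - intros Γ t A H. cbn [check] in H.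
    assert (Hinf : match infer n Γ t with
        | Some T =>
            if tm_beq T A then true
            else match whnf n T, A with
            | Univ i, Univ j => i <=? j
            | _, _ => convb n T A &&& istype n Γ A
            end
        | None => false
        end = true -> has_type Γ t A).
    { clear H. destruct (infer n Γ t) as [T|] eqn:E; [|discriminate].
      destruct (tm_beq T A) eqn:EA; [apply tm_beq_sound in EA as <-; eauto|].
      assert (Hc : (convb n T A &&& istype n Γ A) = true -> has_type Γ t A).
      { intros Hc. apply Bool.andb_true_iff in Hc as [C Hty].
        destruct (IHt _ _ Hty) as [i Hi].
        eapply T_conv; [apply IHi, E | eapply convb_sound, C | exact Hi]. }
      destruct (whnf n T) eqn:W; try exact Hc. destruct A; try exact Hc.
      intros Hle. apply Nat.leb_le in Hle. eauto using has_type_level. }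
    destruct t as [| | | |A1 b|]; try (apply Hinf, H).
    destruct A as [| | |A2 B| |]; try (apply Hinf, H).
    apply Bool.andb_true_iff in H as [H H3]. apply Bool.andb_true_iff in H as [H1 H2].
    destruct (IHt _ _ H1) as [i Hi].
    destruct (tm_beq A1 A2) eqn:EA.
    + apply tm_beq_sound in EA as <-. eapply T_lam; eauto.
    + apply Bool.andb_true_iff in H3 as [C H3]. destruct (IHt _ _ H3) as [j Hj].
      eapply T_conv; [eapply T_lam; eauto | | exact Hj].
      apply conv_pi; [eapply convb_sound, C | constructor].
Qed.

(** Recursion depth of the checker and the elaborator; ample for the terms
    below. *)
Definition fuel : nat := 1000.

Lemma check_closed t A : check fuel [] t A = true -> has_type [] t A.
Proof. apply checker_sound. Qed.

Ltac by_check := intros; apply weaken_closed, check_closed; vm_compute; reflexivity.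

(** * An elaborator *)

(** Terms in which some arguments and all domains of abstractions are left to
    be inferred. *)
Inductive raw : Type :=
| RTm (t : tm)
| RHole
| RLam (b : raw)
| RApp (f a : raw)
| RLet (a b : raw)
| RAnn (a : raw) (A : tm).

(** Nothing is proved about the elaborator, because its output is checked.  An
    application [f a1 ... an] is elaborated as a whole: every argument is first
    replaced by a metavariable, then the metavariables are solved by matching
    the type of the application against the expected type and the types of
    arguments against those that [f] expects. *)

(** A metavariable is written as a universe of a level that does not occur
    otherwise: renaming and substitution leave it alone. *)
Definition meta_base : nat := 100.
Definition meta (k : nat) : tm := Univ (meta_base + k).

Definition is_meta (t : tm) : option nat :=
  match t with
  | Univ l => if meta_base <=? l then Some (l - meta_base) else None
  | _ => None
  end.

Fixpoint has_meta (t : tm) : bool :=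
  match t with
  | Univ l => meta_base <=? l
  | Pi A B | Lam A B | App A B => if has_meta A then true else has_meta B
  | _ => false
  end.

Fixpoint head (t : tm) : tm := match t with App f _ => head f | _ => t end.

Definition lift_by (d : nat) (t : tm) : tm :=
  match d with 0 => t | _ => ren (fun v => d + v) t end.

(** Replaces metavariables by their solutions below [d] binders; a solution that
    is an abstraction is applied by reduction. *)
Fixpoint fill (sols : list (option tm)) (d : nat) (t : tm) : tm :=
  match t with
  | Univ _ =>
      match is_meta t with
      | Some k => match nth k sols None with Some s => lift_by d s | None => t end
      | None => t
      end
  | Pi A B => Pi (fill sols d A) (fill sols (S d) B)
  | Lam A B => Lam (fill sols d A) (fill sols (S d) B)
  | App f a =>
      let a' := fill sols d a in
      match is_meta (head f), fill sols d f with
      | Some _, Lam _ b => subst1 a' b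
      | _, f' => App f' a'
      end
  | _ => t
  end.

Fixpoint rename_opt (d : nat) (f : nat -> option nat) (t : tm) : option tm :=
  let both g A B d' :=
    match rename_opt d f A, rename_opt d' f B with
    | Some A, Some B => Some (g A B)
    | _, _ => None
    end in
  match t with
  | Var v => if v <? d then Some t else option_map (fun w => Var (d + w)) (f (v - d))
  | Pi A B => both Pi A B (S d)
  | Lam A B => both Lam A B (S d)
  | App A B => both App A B d
  | _ => Some t
  end.

Fixpoint index (v : nat) (l : list tm) (k : nat) : option nat :=
  match l with
  | Var w :: l => if v =? w then Some k else index v l (S k)
  | _ => None
  end.

Fixpoint set_nth {A} (k : nat) (x : A) (l : list A) : list A :=
  match k, l with
  | 0, _ :: l => x :: l
  | S k, y :: l => y :: set_nth k x l
  | _, [] => []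
  end.

Fixpoint abstract_as (n : nat) (T b : tm) : option tm :=
  match n with
  | 0 => Some b
  | S n =>
      match whnf fuel T with
      | Pi A B => if has_meta A then None else option_map (Lam A) (abstract_as n B b)
      | _ => None
      end
  end.

(** Pattern unification: a metavariable of type [T] applied to bound variables
    is solved by abstracting these variables from [t]. *)
Definition solve_pattern (d : nat) (args : list tm) (T t : tm) : option tm :=
  let n := length args in
  if forallb (fun a => match a with Var v => v <? d | _ => false end) args then
    match rename_opt 0 (fun v =>
            if v <? d then option_map (fun k => n - S k) (index v args 0)
            else Some (v - d + n)) t with
    | Some b => abstract_as n T b
    | None => None
    end
  else None.

(** Both terms are reduced where they disagree. *)
Fixpoint match_tm (n : nat) (tys : list tm) (sols : list (option tm)) (d : nat)
    (p t : tm) : list (option tm) :=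
  match n with
  | 0 => sols
  | S n =>
    if has_meta p then
      let again (_ : unit) :=
        let p' := whnf fuel p in
        let t' := whnf fuel t in
        if tm_beq p p' &&& tm_beq t t' then sols else match_tm n tys sols d p' t' in
      let (h, args) := spine p [] in
      match is_meta h with
      | Some k =>
          match nth k sols None with
          | Some s => match_tm n tys sols d (whnf fuel (apps (lift_by d s) args)) t
          | None =>
              match solve_pattern d args (fill sols 0 (nth k tys h)) t with
              | Some s => set_nth k (Some s) sols
              | None => match args, t with _ :: _, App _ _ => again tt | _, _ => sols end
              end
          end
      | None =>
          match p, t with
          | Pi A B, Pi A' B' => match_tm n tys (match_tm n tys sols d A A') (S d) B B'
          | Lam A B, Lam A' B' => match_tm n tys (match_tm n tys sols d A A') (S d) B B'
          | App _ _, App _ _ =>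
              let (h', args') := spine t [] in
              if tm_beq h h' &&& (length args =? length args') then
                fold_left (fun sols pt => match_tm n tys sols d (fst pt) (snd pt))
                  (combine args args') sols
              else again tt
          | _, _ => again tt
          end
      end
    else sols
  end.

Fixpoint raw_spine (r : raw) (l : list raw) : raw * list raw :=
  match r with RApp f a => raw_spine f (a :: l) | _ => (r, l) end.

(** Splits the arguments into those for which [T] is visibly a product, paired
    with their types, and the rest. *)
Fixpoint telescope (T : tm) (args : list raw) (k : nat)
  : tm * list (tm * raw) * list raw :=
  match args with
  | [] => (T, [], [])
  | a :: args' =>
      match whnf fuel T with
      | Pi A B =>
          let '(R, l, rest) := telescope (subst1 (meta k) B) args' (S k) in
          (R, (A, a) :: l, rest)
      | _ => (T, [], args)
      end
  end.

Fixpoint all_some {A} (l : list (option A)) : option (list A) :=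
  match l with
  | [] => Some []
  | Some a :: l => option_map (cons a) (all_some l)
  | None :: _ => None
  end.

Definition bind {A B} (x : option A) (f : A -> option B) : option B :=
  match x with Some a => f a | None => None end.

(** Returns the elaborated term and its type, which is the expected type [goal]
    if there is one. *)
Fixpoint elab (n : nat) (Γ : list tm) (goal : option tm) (r : raw) : option (tm * tm) :=
  match n with
  | 0 => None
  | S n =>
    match r with
    | RHole => None
    | RTm t =>
        match goal with
        | Some G => Some (t, G)
        | None => option_map (fun T => (t, T)) (infer fuel Γ t)
        end
    | RLam b =>
        bind goal (fun G =>
          match whnf fuel G with
          | Pi A B => bind (elab n (A :: Γ) (Some B) b) (fun p => Some (Lam A (fst p), G))
          | _ => None
          end)
    | RLet a b =>
        bind (elab n Γ None a) (fun p =>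
        bind (elab n (snd p :: Γ) (option_map lift goal) b) (fun q =>
          Some (App (Lam (snd p) (fst q)) (fst p), subst1 (fst p) (snd q))))
    | RAnn a A => elab n Γ (Some A) a
    | RApp _ _ =>
        let (h, args) := raw_spine r [] in
        bind (elab n Γ None h) (fun p => elab_app n Γ goal (fst p) (snd p) args)
    end
  end
with elab_app (n : nat) (Γ : list tm) (goal : option tm) (h T : tm) (args : list raw)
  : option (tm * tm) :=
  match n, args with
  | 0, _ => None
  | S n, [] => Some (h, match goal with Some G => G | None => T end)
  | S n, _ =>
      let '(R, l, rest) := telescope T args 0 in
      let goal1 := match rest with [] => goal | _ => None end in
      match l with
      | [] => None
      | _ =>
          bind (solve n Γ goal1 (map fst l) R (length l) (map (fun _ => None) l)
                  (combine (seq 0 (length l)) (map snd l)))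
            (fun sols =>
               elab_app n Γ goal (apps h sols) (fill (map Some sols) 0 R) rest)
      end
  end
(* An argument is elaborated once its expected type is known; before that only
   if it is not an abstraction, and then its own type gives information.
   Otherwise it stays on the list [todo] for the next pass. *)
with solve (n : nat) (Γ : list tm) (goal : option tm) (tys : list tm) (R : tm)
    (passes : nat) (sols : list (option tm)) (todo : list (nat * raw))
  : option (list tm) :=
  match n with
  | 0 => None
  | S n =>
    let by_goal sols :=
      match goal with Some G => match_tm fuel tys sols 0 R G | None => sols end in
    bind
      (fold_left (fun st kr => bind st (fun st =>
         let '(sols, todo) := st in
         let (k, r) := (kr : nat * raw) in
         let A := fill sols 0 (nth k tys (Univ 0)) in
         let later := Some (sols, todo ++ [kr]) in
         match r with
         | RHole => Some st
         | _ =>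
           if has_meta A then
             match r with
             | RLam _ => later
             | _ =>
               match elab n Γ None r with
               | Some (t, T) => Some (set_nth k (Some t) (match_tm fuel tys sols 0 A T), todo)
               | None => later
               end
             end
           else bind (elab n Γ (Some A) r) (fun p => Some (set_nth k (Some (fst p)) sols, todo))
         end)) todo (Some (by_goal sols, [])))
      (fun st =>
         let '(sols, todo) := st in
         match todo, passes with
         | [], _ => all_some (by_goal sols)
         | _, 0 => None
         | _, S passes => solve n Γ goal tys R passes sols todo
         end)
  end.

(** * Writing derivations *)

(** As with [stm], a proof term awaits the number of binders above it. *)
Definition sraw : Type := nat -> raw.
Definition of_stm (t : stm) : sraw := fun n => RTm (t n).
Coercion of_stm : stm >-> sraw.

Definition rLam (b : stm -> sraw) : sraw := fun n => RLam (b (sVar n) (S n)).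
Definition rApp (f a : sraw) : sraw := fun n => RApp (f n) (a n).
Definition rLet (a : sraw) (b : stm -> sraw) : sraw :=
  fun n => RLet (a n) (b (sVar n) (S n)).
Definition rAnn (a : sraw) (A : stm) : sraw := fun n => RAnn (a n) (A n).
Definition rHole : sraw := fun _ => RHole.

Declare Scope proof_scope.
Delimit Scope proof_scope with proof.
Bind Scope proof_scope with sraw.
Local Open Scope hott_scope.
Local Open Scope proof_scope.
Local Notation "'fn' x .. y => b" := (rLam (fun x => .. (rLam (fun y => b)) ..))
  (at level 200, x binder, y binder, b at level 200) : proof_scope.
Local Notation "f · a" := (rApp f a) (at level 20, left associativity) : proof_scope.
Local Notation "⋆" := rHole : proof_scope.
Local Notation "'have' x := a ; b" := (rLet a (fun x => b))
  (at level 200, x name, a at level 200, b at level 200) : proof_scope.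
Local Notation "a ::: A" := (rAnn a A%hott) (at level 99) : proof_scope.
Local Notation "⊢ A" := (inhabited_in_HoTT A%hott) (at level 199).

Definition proves (s : sraw) (A : stm) : bool :=
  match elab fuel [] (Some (A 0)) (s 0) with
  | Some (t, _) => check fuel [] t (A 0)
  | None => false
  end.

Lemma proves_sound s A : proves s A = true -> ⊢ A.
Proof.
  unfold proves. destruct (elab _ _ _ _) as [[t T]|]; [|discriminate].
  intros H. exists t. apply check_closed, H.
Qed.

(** An earlier lemma is used as a hypothesis, so its proof term is not checked
    again. *)
Lemma modus_ponens (A B : stm) : (⊢ A ~> B) -> (⊢ A) ->
  tm_beq (B 1) (B 0) &&& scoped 0 (B 0) = true -> ⊢ B.
Proof.
  intros [f Hf] [a Ha] HB. apply Bool.andb_true_iff in HB as [H1 H2].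
  apply tm_beq_sound in H1. exists (App f a). unfold closed_tm in *.
  rewrite <- (subst_closed (B 0) (fun n => match n with 0 => a | S m => Var m end) H2).
  rewrite <- H1. eapply T_app; [exact Hf | exact Ha].
Qed.

Ltac prove s := apply (proves_sound s); vm_compute; reflexivity.

(** [use l1, ..., ln] turns the goal [T] into [T1 ~> ... ~> Tn ~> T], where [Ti]
    is the type proved by [li]. *)
Tactic Notation "use" uconstr(a) :=
  refine (modus_ponens _ _ _ a _); [| vm_compute; reflexivity].
Tactic Notation "use" uconstr(a) "," uconstr(b) := use b; use a.
Tactic Notation "use" uconstr(a) "," uconstr(b) "," uconstr(c) := use c; use a, b.
Tactic Notation "use" uconstr(a) "," uconstr(b) "," uconstr(c) "," uconstr(d) :=
  use d; use a, b, c.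
Tactic Notation "use" uconstr(a) "," uconstr(b) "," uconstr(c) "," uconstr(d) ","
    uconstr(e) := use e; use a, b, c, d.
Tactic Notation "use" uconstr(a) "," uconstr(b) "," uconstr(c) "," uconstr(d) ","
    uconstr(e) "," uconstr(f) := use f; use a, b, c, d, e.
Tactic Notation "use" uconstr(a) "," uconstr(b) "," uconstr(c) "," uconstr(d) ","
    uconstr(e) "," uconstr(f) "," uconstr(g) := use g; use a, b, c, d, e, f.
Tactic Notation "use" uconstr(a) "," uconstr(b) "," uconstr(c) "," uconstr(d) ","
    uconstr(e) "," uconstr(f) "," uconstr(g) "," uconstr(h) :=
  use h; use a, b, c, d, e, f, g.
Tactic Notation "use" uconstr(a) "," uconstr(b) "," uconstr(c) "," uconstr(d) ","
    uconstr(e) "," uconstr(f) "," uconstr(g) "," uconstr(h) "," uconstr(i) :=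
  use i; use a, b, c, d, e, f, g, h.
Tactic Notation "use" uconstr(a) "," uconstr(b) "," uconstr(c) "," uconstr(d) ","
    uconstr(e) "," uconstr(f) "," uconstr(g) "," uconstr(h) "," uconstr(i) ","
    uconstr(j) := use j; use a, b, c, d, e, f, g, h, i.

(** * Identity, truncation and propositions *)

Local Notation V := (sCst (cV 0)).
Definition idV (x y : stm) : stm := tId 1 V x y.
Definition biimp (P Q : stm) : stm := prod 1 (P ~> Q) (Q ~> P).
Definition disj (P Q : stm) : stm := cTr 1 @ (cSum 1 @ P @ Q).

Definition rfl : sraw := cRefl 1 · ⋆ · ⋆.
Definition pair_ (a b : sraw) : sraw := cPair 1 · ⋆ · ⋆ · a · b.
Local Notation "⟨ a , b ⟩" := (pair_ a b) : proof_scope.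
Definition split_ (b : sraw) : sraw := cIndSig 1 1 · ⋆ · ⋆ · ⋆ · b.
Local Notation "'fn⟨' x , y '⟩' => b" := (split_ (fn x y => b))
  (at level 200, x name, y name, b at level 200) : proof_scope.

(** Elimination of a variable [x] has [Π x, C x] as its goal, which determines
    the motive by pattern unification.  For a compound term [u] this fails;
    [unpack u] eliminates it with a constant motive. *)
Definition unpack_fn : stm :=
  λ A : U 1, λ B : A ~> U 1, λ P : U 1, λ f : (Π a : A, B @ a ~> P),
  λ u : sig 1 A (fun a => B @ a),
  cIndSig 1 1 @ A @ B @ (λ _ : sig 1 A (fun a => B @ a), P) @ f @ u.
Definition unpack (u f : sraw) : sraw := unpack_fn · ⋆ · ⋆ · ⋆ · f · u.

Definition fst_fn : stm :=
  λ A : U 1, λ B : U 1, λ u : prod 1 A B, pr1 1 A (fun _ => B) u.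
Definition snd_fn : stm :=
  λ A : U 1, λ B : U 1, λ u : prod 1 A B, pr2 1 A (fun _ => B) u.
Definition fst_ (u : sraw) : sraw := fst_fn · ⋆ · ⋆ · u.
Definition snd_ (u : sraw) : sraw := snd_fn · ⋆ · ⋆ · u.

Definition tr_rec_fn (i k : nat) : stm :=
  λ A : U i, λ P : U k, λ h : isProp k P, λ f : A ~> P,
  cIndTr i k @ A @ (λ _ : cTr i @ A, P) @ f
    @ (λ x : cTr i @ A, λ y : cTr i @ A, λ u : P, λ v : P,
         h @ transport i k (cTr i @ A) (λ _ : cTr i @ A, P) x y
               (cTrPath i @ A @ x @ y) u @ v).
Definition tr_rec (h f t : sraw) : sraw := tr_rec_fn 1 1 · ⋆ · ⋆ · h · f · t.
Definition tr_bind (f t : sraw) : sraw := tr_rec (cTrPath 1 · ⋆) f t.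
Definition tr_in (a : sraw) : sraw := cTrIn 1 · ⋆ · a.

Definition cases (f g : sraw) : sraw := cIndSum 1 1 · ⋆ · ⋆ · ⋆ · f · g.
Definition cases0 (f g : sraw) : sraw := cIndSum 0 1 · ⋆ · ⋆ · ⋆ · f · g.
Definition left_ (p : sraw) : sraw := tr_in (cInl 1 · ⋆ · ⋆ · p).
Definition right_ (p : sraw) : sraw := tr_in (cInr 1 · ⋆ · ⋆ · p).

Lemma fun_ext : ⊢ Π A : U 1, Π B : A ~> U 1, Π f : (Π x : A, B @ x), Π g : (Π x : A, B @ x),
  (Π x : A, tId 1 (B @ x) (f @ x) (g @ x)) ~> tId 1 (Π x : A, B @ x) f g.
Proof. prove (fn A B f g e => funext 1 A B f g e). Qed.

Lemma ap_path : ⊢ Π A : U 1, Π B : U 1, Π f : A ~> B, Π x : A, Π y : A,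
  tId 1 A x y ~> tId 1 B (f @ x) (f @ y).
Proof. prove (fn A B f => cIndId 1 1 · ⋆ · ⋆ · (fn x => rfl)). Qed.

Lemma transp : ⊢ Π A : U 1, Π P : A ~> U 1, Π x : A, Π y : A, tId 1 A x y ~> P @ x ~> P @ y.
Proof. prove (fn A P => cIndId 1 1 · ⋆ · ⋆ · (fn x u => u)). Qed.

Lemma sym : ⊢ Π A : U 1, Π x : A, Π y : A, tId 1 A x y ~> tId 1 A y x.
Proof. prove (fn A => cIndId 1 1 · ⋆ · ⋆ · (fn x => rfl)). Qed.

Lemma trans : ⊢ Π A : U 1, Π x : A, Π y : A, Π z : A,
  tId 1 A x y ~> tId 1 A y z ~> tId 1 A x z.
Proof. prove (fn A x y z p q => concat 1 A x y z p q). Qed.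

(** Identity types of different levels are different types, so facts about small
    types have to be raised to the level of [V]. *)
Lemma id_raise : ⊢ Π A : U 0, Π x : A, Π y : A, tId 0 A x y ~> tId 1 A x y.
Proof. prove (fn A => cIndId 0 1 · ⋆ · ⋆ · (fn x => rfl)). Qed.

Lemma isProp_raise : ⊢ Π A : U 0, isProp 0 A ~> isProp 1 A.
Proof.
  use id_raise.
  prove (fn id_raise A h x y => id_raise · ⋆ · ⋆ · ⋆ · (h · x · y)).
Qed.

Lemma isProp_pi : ⊢ Π A : U 1, Π B : A ~> U 1,
  (Π x : A, isProp 1 (B @ x)) ~> isProp 1 (Π x : A, B @ x).
Proof.
  use fun_ext.
  prove (fn fun_ext A B h f g => fun_ext · ⋆ · ⋆ · ⋆ · ⋆ · (fn x => h · x · ⋆ · ⋆)).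
Qed.

Lemma isProp_pi0 : ⊢ Π A : U 0, Π B : A ~> U 0,
  (Π x : A, isProp 0 (B @ x)) ~> isProp 0 (Π x : A, B @ x).
Proof.
  prove (fn A B h f g => funext 0 A B f g (λ x : A, h @ x @ (f @ x) @ (g @ x))).
Qed.

Lemma subtype_path : ⊢ Π A : U 1, Π B : A ~> U 1, (Π x : A, isProp 1 (B @ x)) ~>
  Π a : A, Π b : A, tId 1 A a b ~> Π u : B @ a, Π v : B @ b,
  tId 1 (sig 1 A (fun x => B @ x))
    (pair 1 A (fun x => B @ x) a u) (pair 1 A (fun x => B @ x) b v).
Proof.
  use ap_path.
  prove (fn ap_path A B h => cIndId 1 1 · ⋆ · ⋆ · (fn a u v =>
    ap_path · ⋆ · ⋆ · (λ w : B @ a, pair 1 A (fun x => B @ x) a w) · ⋆ · ⋆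
      · (h · a · u · v))).
Qed.

Lemma isProp_and : ⊢ Π A : U 1, Π B : U 1,
  isProp 1 A ~> isProp 1 B ~> isProp 1 (prod 1 A B).
Proof.
  use subtype_path.
  prove (fn subtype_path A B hA hB => fn⟨a, u⟩ => fn⟨b, v⟩ =>
    subtype_path · ⋆ · ⋆ · (fn _ => hB) · ⋆ · ⋆ · (hA · a · b) · u · v).
Qed.

Lemma isProp_biimp : ⊢ Π P : U 1, Π Q : U 1,
  isProp 1 P ~> isProp 1 Q ~> isProp 1 (biimp P Q).
Proof.
  use isProp_and, isProp_pi.
  prove (fn isProp_and isProp_pi P Q hP hQ => isProp_and · ⋆ · ⋆
    · (isProp_pi · ⋆ · ⋆ · (fn _ => hQ)) · (isProp_pi · ⋆ · ⋆ · (fn _ => hP))).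
Qed.

Lemma isProp_empty : ⊢ isProp 1 cEmpty.
Proof. prove (cIndEmpty 1 · (λ x : cEmpty, Π y : cEmpty, tId 1 cEmpty x y)). Qed.

Lemma isProp_isProp0 : ⊢ Π A : U 0, isProp 1 (isProp 0 A).
Proof.
  use isProp_raise.
  prove (fn isProp_raise A => isProp_raise · ⋆ · (isProp_isProp 0 @ A)).
Qed.

Lemma isProp_of_inhab : ⊢ Π A : U 1, (A ~> isProp 1 A) ~> isProp 1 A.
Proof. prove (fn A h x y => h · x · x · y). Qed.

Lemma isSet_of_isProp : ⊢ Π A : U 1, isProp 1 A ~> isSet 1 A.
Proof. prove (set_of_prop 1). Qed.

(** Not an axiom of choice, as existence is untruncated. *)
Lemma choice : ⊢ Π A : U 1, Π B : A ~> U 1, Π R : (Π a : A, B @ a ~> U 1),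
  (Π a : A, sig 1 (B @ a) (fun b => R @ a @ b)) ~>
  sig 1 (Π a : A, B @ a) (fun f => Π a : A, R @ a @ (f @ a)).
Proof.
  prove (fn A B R c =>
    ⟨(λ a : A, pr1 1 (B @ a) (fun b => R @ a @ b) (c @ a)),
     fn a => pr2 1 (B @ a) (fun b => R @ a @ b) (c @ a)⟩).
Qed.

(** The clause for the equality constructor is an identity in a proposition. *)
Lemma V_prop_ind : ⊢ Π P : V ~> U 1, (Π x : V, isProp 1 (P @ x)) ~>
  (Π A : U 0, Π f : A ~> V, (Π a : A, P @ (f @ a)) ~> P @ (cSet 0 @ A @ f)) ~>
  Π x : V, P @ x.
Proof.
  use isSet_of_isProp.
  prove (fn isSet_of_isProp P h c => cIndV 0 1 · P · (fn x => isSet_of_isProp · ⋆ · (h · x))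
    · c · (fn A B f g e u v _ => h · ⋆ · ⋆ · ⋆)).
Qed.

Lemma quo_prop_ind : ⊢ Π A : U 0, Π R : A ~> A ~> U 0, Π P : cQuo 0 @ A @ R ~> U 1,
  (Π x : cQuo 0 @ A @ R, isProp 1 (P @ x)) ~>
  (Π a : A, P @ (cQuoIn 0 @ A @ R @ a)) ~> Π x : cQuo 0 @ A @ R, P @ x.
Proof.
  use isSet_of_isProp.
  prove (fn isSet_of_isProp A R P h c =>
    cIndQuo 0 1 · A · R · P · (fn x => isSet_of_isProp · ⋆ · (h · x)) · c
      · (fn a b r => h · ⋆ · ⋆ · ⋆)).
Qed.

(** * Small propositions *)

Definition isSmall_by (P Q : stm) : stm :=
  prod 1 (isProp 0 Q) (prod 1 (Q ~> P) (P ~> Q)).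
Definition isSmall (P : stm) : stm := sig 1 (U 0) (fun Q => isSmall_by P Q).
Definition resize (P s : stm) : stm := pr1 1 (U 0) (fun Q => isSmall_by P Q) s.

Definition res_prop (r : sraw) : sraw := fst_ r.
Definition res_out (r : sraw) : sraw := fst_ (snd_ r).
Definition res_in (r : sraw) : sraw := snd_ (snd_ r).

Lemma resize_spec : ⊢ Π P : U 1, Π s : isSmall P, isSmall_by P (resize P s).
Proof. prove (fn P => cIndSig 1 1 · ⋆ · ⋆ · ⋆ · (fn Q r => r)). Qed.

Lemma propext0 : ⊢ Π P : U 0, Π Q : U 0,
  isProp 0 P ~> isProp 0 Q ~> (P ~> Q) ~> (Q ~> P) ~> tId 1 (U 0) P Q.
Proof. prove (propext 0). Qed.

(** Two small equivalents of a proposition are equivalent to each other, hence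
    equal.  So smallness of a family of propositions can be proved by induction
    on [V], and it provides a family in [U] without choice. *)
Lemma isProp_isSmall : ⊢ Π P : U 1, isProp 1 P ~> isProp 1 (isSmall P).
Proof.
  use isProp_raise, isProp_of_inhab, isProp_isProp0, isProp_and, isProp_pi, propext0,
    subtype_path.
  prove (fn isProp_raise isProp_of_inhab isProp_isProp0 isProp_and isProp_pi propext0
            subtype_path P hP =>
    fn⟨Q, r⟩ => fn⟨Q', r'⟩ =>
      subtype_path · ⋆ · ⋆
        · (fn X => isProp_of_inhab · ⋆ · (fn⟨hX, _⟩ =>
             isProp_and · ⋆ · ⋆ · (isProp_isProp0 · ⋆)
               · (isProp_and · ⋆ · ⋆ · (isProp_pi · ⋆ · ⋆ · (fn _ => hP))
                    · (isProp_pi · ⋆ · ⋆ · (fn _ => isProp_raise · ⋆ · hX)))))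
        · ⋆ · ⋆
        · (propext0 · Q · Q' · res_prop r · res_prop r'
             · (fn q => res_in r' · (res_out r · q))
             · (fn q => res_in r · (res_out r' · q)))
        · r · r').
Qed.

Lemma small_biimp : ⊢ Π P : U 1, Π P' : U 1,
  isSmall P ~> (P ~> P') ~> (P' ~> P) ~> isSmall P'.
Proof.
  prove (fn P P' => fn⟨Q, r⟩ => fn f g =>
    ⟨Q, ⟨res_prop r, ⟨fn q => f · (res_out r · q), fn p => res_in r · (g · p)⟩⟩⟩).
Qed.

Lemma small_empty : ⊢ isSmall cEmpty.
Proof.
  prove ⟨cEmpty, ⟨cIndEmpty 0 · (λ x : cEmpty, Π y : cEmpty, tId 0 cEmpty x y),
                  ⟨fn x => x, fn x => x⟩⟩⟩.
Qed.

Lemma small_imp : ⊢ Π P : U 1, Π P' : U 1, isSmall P ~> isSmall P' ~> isSmall (P ~> P').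
Proof.
  prove (fn P P' => fn⟨Q, r⟩ => fn⟨Q', r'⟩ =>
    ⟨(Q ~> Q')%hott, ⟨isProp_arrow 0 · ⋆ · ⋆ · res_prop r',
      ⟨fn h p => res_out r' · (h · (res_in r · p)),
       fn h q => res_in r' · (h · (res_out r · q))⟩⟩⟩).
Qed.

Lemma small_and : ⊢ Π P : U 1, Π P' : U 1,
  isSmall P ~> isSmall P' ~> isSmall (prod 1 P P').
Proof.
  prove (fn P P' => fn⟨Q, r⟩ => fn⟨Q', r'⟩ =>
    ⟨prod 0 Q Q', ⟨isProp_prod 0 · ⋆ · ⋆ · res_prop r · res_prop r',
      ⟨cIndSig 0 1 · ⋆ · ⋆ · ⋆ · (fn q q' => ⟨res_out r · q, res_out r' · q'⟩),
       cIndSig 1 0 · ⋆ · ⋆ · ⋆ · (fn p p' =>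
         cPair 0 · ⋆ · ⋆ · (res_in r · p) · (res_in r' · p'))⟩⟩⟩).
Qed.

Lemma small_or : ⊢ Π P : U 1, Π P' : U 1, isSmall P ~> isSmall P' ~> isSmall (disj P P').
Proof.
  prove (fn P P' => fn⟨Q, r⟩ => fn⟨Q', r'⟩ =>
    ⟨(cTr 0 @ (cSum 0 @ Q @ Q')), ⟨cTrPath 0 · ⋆,
      ⟨tr_rec_fn 0 1 · ⋆ · ⋆ · (cTrPath 1 · ⋆)
         · cases0 (fn q => left_ (res_out r · q)) (fn q => right_ (res_out r' · q)),
       tr_rec_fn 1 0 · ⋆ · ⋆ · (cTrPath 0 · ⋆) · (cIndSum 1 0 · ⋆ · ⋆ · ⋆
         · (fn p => cTrIn 0 · ⋆ · (cInl 0 · ⋆ · ⋆ · (res_in r · p)))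
         · (fn p => cTrIn 0 · ⋆ · (cInr 0 · ⋆ · ⋆ · (res_in r' · p))))⟩⟩⟩).
Qed.

Lemma small_pi : ⊢ Π A : U 0, Π P : A ~> U 1,
  (Π a : A, isSmall (P @ a)) ~> isSmall (Π a : A, P @ a).
Proof.
  use resize_spec, isProp_pi0.
  prove (fn spec isProp_pi0 A P h =>
    ⟨(Π a : A, resize (P @ a) (h @ a))%hott,
      ⟨isProp_pi0 · ⋆ · ⋆ · (fn a => res_prop (spec · ⋆ · (h · a))),
       ⟨fn k a => res_out (spec · ⋆ · (h · a)) · (k · a),
        fn k a => res_in (spec · ⋆ · (h · a)) · (k · a)⟩⟩⟩).
Qed.

Lemma small_ex : ⊢ Π A : U 0, Π P : A ~> U 1,
  (Π a : A, isSmall (P @ a)) ~> isSmall (ex 1 A (fun a => P @ a)).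
Proof.
  use resize_spec.
  prove (fn spec A P h =>
    ⟨(cTr 0 @ sig 0 A (fun a => resize (P @ a) (h @ a))),
      ⟨cTrPath 0 · ⋆,
       ⟨tr_rec_fn 0 1 · ⋆ · ⋆ · (cTrPath 1 · ⋆) · (cIndSig 0 1 · ⋆ · ⋆ · ⋆ · (fn a q =>
          tr_in ⟨a, res_out (spec · ⋆ · (h · a)) · q⟩)),
        tr_rec_fn 1 0 · ⋆ · ⋆ · (cTrPath 0 · ⋆) · (cIndSig 1 0 · ⋆ · ⋆ · ⋆ · (fn a p =>
          cTrIn 0 · ⋆ · (cPair 0 · ⋆ · ⋆ · a · (res_in (spec · ⋆ · (h · a)) · p))))⟩⟩⟩).
Qed.

(** * Extensionality and smallness of the atomic formulas *)

Definition ex_eq (x A f : stm) : stm := ex 1 A (fun a => idV x (f @ a)).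
Definition mem_prop (m : stm) : stm := Π x : V, Π y : V, isProp 1 (m @ x @ y).
Definition mem_intro (m : stm) : stm :=
  Π x : V, Π A : U 0, Π f : A ~> V, ex_eq x A f ~> m @ x @ (cSet 0 @ A @ f).
Definition mem_elim (m : stm) : stm :=
  Π x : V, Π A : U 0, Π f : A ~> V, m @ x @ (cSet 0 @ A @ f) ~> ex_eq x A f.

(** The laws determine [m] up to equivalence, and are all that is used of
    membership. *)
Definition forall_mem (T : stm -> stm) : stm :=
  Π m : V ~> V ~> U 1, mem_prop m ~> mem_intro m ~> mem_elim m ~> T m.

Lemma ex_sym : ⊢ Π A : U 0, Π f : A ~> V, Π z : V,
  ex_eq z A f ~> ex 1 A (fun a => idV (f @ a) z).
Proof.
  use sym.
  prove (fn sym A f z t => tr_bind (fn⟨a, p⟩ => tr_in ⟨a, sym · ⋆ · ⋆ · ⋆ · p⟩) t).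
Qed.

Lemma extensionality : ⊢ forall_mem (fun m =>
  Π x : V, Π y : V, (Π z : V, biimp (m @ z @ x) (m @ z @ y)) ~> idV x y).
Proof.
  use V_prop_ind, isProp_pi, ex_sym.
  prove (fn V_prop_ind isProp_pi ex_sym m hp hi ho =>
    V_prop_ind · ⋆
      · (fn x => isProp_pi · ⋆ · ⋆ · (fn y => isProp_pi · ⋆ · ⋆ · (fn _ => cVSet 0 · ⋆ · ⋆)))
      · (fn A f _ => V_prop_ind · ⋆
           · (fn y => isProp_pi · ⋆ · ⋆ · (fn _ => cVSet 0 · ⋆ · ⋆))
           · (fn B g _ h => cSetExt 0 · ⋆ · ⋆ · ⋆ · ⋆ ·
                ⟨fn a => ho · ⋆ · ⋆ · ⋆ ·
                   (fst_ (h · (f @ a)) · (hi · ⋆ · ⋆ · ⋆ · tr_in ⟨a, rfl⟩)),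
                 fn b => ex_sym · ⋆ · ⋆ · ⋆ · (ho · ⋆ · ⋆ · ⋆ ·
                   (snd_ (h · (g @ b)) · (hi · ⋆ · ⋆ · ⋆ · tr_in ⟨b, rfl⟩)))⟩))).
Qed.

(** [set A f = set B g] is equivalent to the hypothesis of the equality
    constructor, a combination of the identities [f a = g b] with quantifiers
    over [A] and [B]. *)
Lemma small_eq : ⊢ forall_mem (fun m => Π x : V, Π y : V, isSmall (idV x y)).
Proof.
  use V_prop_ind, isProp_pi, isProp_isSmall, small_pi, small_ex, small_and, small_biimp,
    ex_sym, transp, sym.
  prove (fn V_prop_ind isProp_pi isProp_isSmall small_pi small_ex small_and small_biimp
            ex_sym transp sym m hp hi ho =>
    V_prop_ind · ⋆
      · (fn x => isProp_pi · ⋆ · ⋆ · (fn y => isProp_isSmall · ⋆ · (cVSet 0 · ⋆ · ⋆)))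
      · (fn A f IH => V_prop_ind · ⋆ · (fn y => isProp_isSmall · ⋆ · (cVSet 0 · ⋆ · ⋆))
         · (fn B g _ =>
              small_biimp · (bitotal 1 A B (fun a b => idV (f @ a) (g @ b))) · ⋆
                · (small_and · ⋆ · ⋆
                     · (small_pi · ⋆ · ⋆ · (fn a => small_ex · ⋆ · ⋆ · (fn b => IH · a · (g @ b))))
                     · (small_pi · ⋆ · ⋆ · (fn b => small_ex · ⋆ · ⋆ · (fn a => IH · a · (g @ b)))))
                · (cSetExt 0 · ⋆ · ⋆ · ⋆ · ⋆)
                · (fn p =>
                     ⟨fn a => ho · ⋆ · ⋆ · ⋆ · (transp · ⋆ · (m @ (f @ a)) · ⋆ · ⋆ · p
                        · (hi · ⋆ · ⋆ · ⋆ · tr_in ⟨a, rfl⟩)),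
                      fn b => ex_sym · ⋆ · ⋆ · ⋆ · (ho · ⋆ · ⋆ · ⋆
                        · (transp · ⋆ · (m @ (g @ b)) · ⋆ · ⋆ · (sym · ⋆ · ⋆ · ⋆ · p)
                             · (hi · ⋆ · ⋆ · ⋆ · tr_in ⟨b, rfl⟩)))⟩)))).
Qed.

Lemma small_mem : ⊢ forall_mem (fun m => Π x : V, Π y : V, isSmall (m @ x @ y)).
Proof.
  use V_prop_ind, isProp_isSmall, small_ex, small_biimp, small_eq.
  prove (fn V_prop_ind isProp_isSmall small_ex small_biimp small_eq m hp hi ho => fn x =>
    V_prop_ind · ⋆ · (fn y => isProp_isSmall · ⋆ · (hp · ⋆ · ⋆))
      · (fn A f _ => small_biimp · (ex_eq x A f) · ⋆
           · (small_ex · ⋆ · ⋆ · (fn a => small_eq · m · hp · hi · ho · x · (f @ a)))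
           · (hi · ⋆ · ⋆ · ⋆) · (ho · ⋆ · ⋆ · ⋆))).
Qed.

Definition props_on_V (φ : stm) : stm := Π x : V, isProp 1 (φ @ x).
Definition small_on_V (φ : stm) : stm := Π x : V, isSmall (φ @ x).

Lemma small_ball : ⊢ forall_mem (fun m => Π φ : V ~> U 1,
  props_on_V φ ~> small_on_V φ ~> Π y : V, isSmall (Π x : V, m @ x @ y ~> φ @ x)).
Proof.
  use V_prop_ind, isProp_pi, isProp_isSmall, small_pi, small_biimp, transp, sym.
  prove (fn V_prop_ind isProp_pi isProp_isSmall small_pi small_biimp transp sym m hp hi ho =>
    fn φ hφ sφ =>
    V_prop_ind · ⋆
      · (fn y => isProp_isSmall · ⋆
           · (isProp_pi · ⋆ · ⋆ · (fn x => isProp_pi · ⋆ · ⋆ · (fn _ => hφ · ⋆))))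
      · (fn A f _ => small_biimp · (Π a : A, φ @ (f @ a))%hott · ⋆
           · (small_pi · ⋆ · ⋆ · (fn a => sφ · (f @ a)))
           · (fn h x u => tr_rec (hφ · x)
                (fn⟨a, p⟩ => transp · ⋆ · φ · ⋆ · ⋆ · (sym · ⋆ · ⋆ · ⋆ · p) · (h · a))
                (ho · ⋆ · ⋆ · ⋆ · u))
           · (fn h a => h · ⋆ · (hi · ⋆ · ⋆ · ⋆ · tr_in ⟨a, rfl⟩)))).
Qed.

Lemma small_bex : ⊢ forall_mem (fun m => Π φ : V ~> U 1, small_on_V φ ~>
  Π y : V, isSmall (ex 1 V (fun x => prod 1 (m @ x @ y) (φ @ x)))).
Proof.
  use V_prop_ind, isProp_isSmall, small_ex, small_biimp, transp.
  prove (fn V_prop_ind isProp_isSmall small_ex small_biimp transp m hp hi ho => fn φ sφ =>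
    V_prop_ind · ⋆ · (fn y => isProp_isSmall · ⋆ · (cTrPath 1 · ⋆))
      · (fn A f _ => small_biimp · (ex 1 A (fun a => φ @ (f @ a))) · ⋆
           · (small_ex · ⋆ · ⋆ · (fn a => sφ · (f @ a)))
           · (fn t => tr_bind (fn⟨a, u⟩ =>
                tr_in ⟨f @ a, ⟨hi · ⋆ · ⋆ · ⋆ · tr_in ⟨a, rfl⟩, u⟩⟩) t)
           · (fn t => tr_bind (fn⟨x, u⟩ =>
                tr_bind (fn⟨a, p⟩ => tr_in ⟨a, transp · ⋆ · φ · ⋆ · ⋆ · p · snd_ u⟩)
                  (ho · ⋆ · ⋆ · ⋆ · fst_ u)) t))).
Qed.

(** * Separation, pairing and replacement *)

(** The sum over [A] of the small equivalents of the [P a] is a type in [U]. *)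
Lemma comprehension : ⊢ forall_mem (fun m => Π A : U 0, Π f : A ~> V, Π P : A ~> U 1,
  (Π a : A, isSmall (P @ a)) ~>
  ex 1 V (fun w => Π x : V,
    biimp (m @ x @ w) (ex 1 A (fun a => prod 1 (idV x (f @ a)) (P @ a))))).
Proof.
  use resize_spec.
  prove (fn spec m hp hi ho => fn A f P s =>
    let B a := resize (P @ a) (s @ a) in
    tr_in ⟨(cSet 0 @ sig 0 A B @ λ s : sig 0 A B, f @ pr1 0 A B s),
      fn x =>
        ⟨fn u => tr_bind
           (split_ (cIndSig 0 1 · ⋆ · ⋆ · ⋆ · (fn a q p =>
              tr_in ⟨a, ⟨p, res_out (spec · ⋆ · (s · a)) · q⟩⟩)))
           (ho · ⋆ · ⋆ · ⋆ · u),
         fn u => hi · ⋆ · ⋆ · ⋆ · tr_bind (fn⟨a, r⟩ =>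
           tr_in ⟨cPair 0 · ⋆ · ⋆ · a · (res_in (spec · ⋆ · (s · a)) · snd_ r), fst_ r⟩) u⟩⟩).
Qed.

Lemma separation : ⊢ forall_mem (fun m => Π φ : V ~> U 1,
  props_on_V φ ~> small_on_V φ ~>
  Π y : V, ex 1 V (fun w => Π x : V, biimp (m @ x @ w) (prod 1 (m @ x @ y) (φ @ x)))).
Proof.
  use V_prop_ind, isProp_and, comprehension, transp, sym.
  prove (fn V_prop_ind isProp_and comprehension transp sym m hp hi ho => fn φ hφ sφ =>
    V_prop_ind · ⋆ · (fn y => cTrPath 1 · ⋆)
      · (fn A f _ => tr_bind
           (fn⟨w, h⟩ => tr_in ⟨w, fn x =>
              ⟨fn u => tr_rec (isProp_and · ⋆ · ⋆ · (hp · ⋆ · ⋆) · (hφ · x))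
                 (fn⟨a, r⟩ => ⟨hi · ⋆ · ⋆ · ⋆ · tr_in ⟨a, fst_ r⟩,
                    transp · ⋆ · φ · ⋆ · ⋆ · (sym · ⋆ · ⋆ · ⋆ · fst_ r) · snd_ r⟩)
                 (fst_ (h · x) · u),
               fn u => snd_ (h · x) · tr_bind
                 (fn⟨a, p⟩ => tr_in ⟨a, ⟨p, transp · ⋆ · φ · ⋆ · ⋆ · p · snd_ u⟩⟩)
                 (ho · ⋆ · ⋆ · ⋆ · fst_ u)⟩⟩)
           (comprehension · m · hp · hi · ho · A · f · (λ a : A, φ @ (f @ a))
              · (fn a => sφ · (f @ a))))).
Qed.

Lemma empty_set : ⊢ forall_mem (fun m => ex 1 V (fun x => Π y : V, m @ y @ x ~> cEmpty)).
Proof.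
  use isProp_empty.
  prove (fn isProp_empty m hp hi ho =>
    tr_in ⟨(cSet 0 @ cEmpty @ (cIndEmpty 1 @ (λ _ : cEmpty, V))),
      fn y u => tr_rec isProp_empty (fn⟨e, _⟩ => e) (ho · ⋆ · ⋆ · ⋆ · u)⟩).
Qed.

Definition sum_rec0 (A B f g : stm) : stm :=
  cIndSum 0 1 @ A @ B @ (λ _ : cSum 0 @ A @ B, V) @ f @ g.

Lemma pairing : ⊢ forall_mem (fun m => Π a : V, Π b : V, ex 1 V (fun z => Π w : V,
  biimp (m @ w @ z) (disj (idV w a) (idV w b)))).
Proof.
  prove (fn m hp hi ho => fn a b =>
    tr_in ⟨(cSet 0 @ (cSum 0 @ cUnit @ cUnit)
              @ sum_rec0 cUnit cUnit (λ _ : cUnit, a) (λ _ : cUnit, b)),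
      fn w =>
        ⟨fn u => tr_bind (split_ (cases0 (fn _ p => left_ p) (fn _ p => right_ p)))
           (ho · ⋆ · ⋆ · ⋆ · u),
         fn u => hi · ⋆ · ⋆ · ⋆ · tr_bind
           (cases (fn p => tr_in ⟨cInl 0 · ⋆ · ⋆ · cTt, p⟩)
                  (fn p => tr_in ⟨cInr 0 · ⋆ · ⋆ · cTt, p⟩)) u⟩⟩).
Qed.

Lemma isProp_unique : ⊢ Π P : V ~> U 1, props_on_V P ~>
  isProp 1 (sig 1 V (fun y => prod 1 (P @ y) (Π z : V, P @ z ~> idV z y))).
Proof.
  use subtype_path, isProp_and, isProp_pi.
  prove (fn subtype_path isProp_and isProp_pi P hP => fn⟨y, h⟩ => fn⟨y', h'⟩ =>
    subtype_path · ⋆ · ⋆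
      · (fn w => isProp_and · ⋆ · ⋆ · (hP · w)
           · (isProp_pi · ⋆ · ⋆ · (fn z => isProp_pi · ⋆ · ⋆ · (fn _ => cVSet 0 · ⋆ · ⋆))))
      · ⋆ · ⋆ · (snd_ h' · ⋆ · fst_ h) · h · h').
Qed.

(** Uniqueness makes the untruncated sum a proposition, into which the truncation
    can be eliminated. *)
Lemma unique_choice : ⊢ Π φ : V ~> V ~> U 1, (Π x : V, Π y : V, isProp 1 (φ @ x @ y)) ~>
  (Π x : V, ex 1 V (fun y => prod 1 (φ @ x @ y) (Π z : V, φ @ x @ z ~> idV z y))) ~>
  sig 1 (V ~> V) (fun F =>
    Π x : V, prod 1 (φ @ x @ (F @ x)) (Π z : V, φ @ x @ z ~> idV z (F @ x))).
Proof.
  use choice, isProp_unique.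
  prove (fn choice isProp_unique φ hφ h =>
    choice · V · (λ _ : V, V)
      · (λ x : V, λ y : V, prod 1 (φ @ x @ y) (Π z : V, φ @ x @ z ~> idV z y))
      · (fn x => tr_rec (isProp_unique · (φ @ x) · (hφ · x)) (fn r => r) (h · x))).
Qed.

Lemma replacement : ⊢ forall_mem (fun m => Π φ : V ~> V ~> U 1,
  (Π x : V, Π y : V, isProp 1 (φ @ x @ y)) ~>
  Π S : V, (Π x : V, ex 1 V (fun y => prod 1 (φ @ x @ y) (Π z : V, φ @ x @ z ~> idV z y))) ~>
  ex 1 V (fun w => Π v : V,
    biimp (m @ v @ w) (ex 1 V (fun u => prod 1 (m @ u @ S) (φ @ u @ v))))).
Proof.
  use V_prop_ind, isProp_pi, unique_choice, transp, sym.
  prove (fn V_prop_ind isProp_pi unique_choice transp sym m hp hi ho => fn φ hφ =>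
    V_prop_ind · ⋆ · (fn y => isProp_pi · ⋆ · ⋆ · (fn _ => cTrPath 1 · ⋆))
      · (fn A f _ h => unpack (unique_choice · φ · hφ · h) (fn F hF =>
           tr_in ⟨(cSet 0 @ A @ λ a : A, F @ (f @ a)), fn v =>
             ⟨fn k => tr_bind
                (fn⟨a, p⟩ => tr_in ⟨f @ a, ⟨hi · ⋆ · ⋆ · ⋆ · tr_in ⟨a, rfl⟩,
                   transp · ⋆ · (φ @ (f @ a)) · ⋆ · ⋆ · (sym · ⋆ · ⋆ · ⋆ · p)
                     · fst_ (hF · (f @ a))⟩⟩)
                (ho · ⋆ · ⋆ · ⋆ · k),
              fn k => hi · ⋆ · ⋆ · ⋆ · tr_bind
                (fn⟨u, r⟩ => tr_bind
                   (fn⟨a, p⟩ => tr_in ⟨a, snd_ (hF · (f @ a)) · v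
                      · (transp · ⋆ · (λ x : V, φ @ x @ v) · ⋆ · ⋆ · p · snd_ r)⟩)
                   (ho · ⋆ · ⋆ · ⋆ · fst_ r)) k⟩⟩))).
Qed.

(** * Infinity *)

Definition is_empty (m e : stm) : stm := Π z : V, m @ z @ e ~> cEmpty.
Definition is_succ (m y s : stm) : stm :=
  Π z : V, biimp (m @ z @ s) (disj (m @ z @ y) (idV z y)).
Definition is_inductive (m x : stm) : stm :=
  prod 1 (ex 1 V (fun e => prod 1 (m @ e @ x) (is_empty m e)))
    (Π y : V, m @ y @ x ~> ex 1 V (fun s => prod 1 (m @ s @ x) (is_succ m y s))).
Definition least_inductive (m : stm) : stm :=
  ex 1 V (fun a => prod 1 (is_inductive m a)
    (Π b : V, is_inductive m b ~> Π z : V, m @ z @ a ~> m @ z @ b)).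

(** By extensionality. *)
Lemma isProp_specified : ⊢ forall_mem (fun m => Π P : V ~> U 1, props_on_V P ~>
  isProp 1 (sig 1 V (fun s => Π z : V, biimp (m @ z @ s) (P @ z)))).
Proof.
  use subtype_path, isProp_pi, isProp_biimp, extensionality.
  prove (fn subtype_path isProp_pi isProp_biimp ext m hp hi ho => fn P hP =>
    fn⟨s, h⟩ => fn⟨s', h'⟩ =>
    subtype_path · ⋆ · ⋆
      · (fn w => isProp_pi · ⋆ · ⋆ · (fn z => isProp_biimp · ⋆ · ⋆ · (hp · ⋆ · ⋆) · (hP · ⋆)))
      · ⋆ · ⋆
      · (ext · m · hp · hi · ho · ⋆ · ⋆ · (fn z =>
           ⟨fn u => snd_ (h' · z) · (fst_ (h · z) · u),
            fn u => snd_ (h · z) · (fst_ (h' · z) · u)⟩))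
      · h · h').
Qed.

(** The successor is unique, so its existence is a proposition even without
    truncation, and induction on [V] makes it a function. *)
Lemma successor : ⊢ forall_mem (fun m => Π y : V, sig 1 V (fun s => is_succ m y s)).
Proof.
  use V_prop_ind, isProp_specified.
  prove (fn V_prop_ind specified m hp hi ho =>
    V_prop_ind · ⋆
      · (fn y => specified · m · hp · hi · ho · (λ z : V, disj (m @ z @ y) (idV z y))
           · (fn z => cTrPath 1 · ⋆))
      · (fn A f _ =>
           ⟨(cSet 0 @ (cSum 0 @ A @ cUnit) @ sum_rec0 A cUnit f (λ _ : cUnit, cSet 0 @ A @ f)),
            fn z =>
             ⟨fn u => tr_bind
                (split_ (cases0 (fn a p => left_ (hi · ⋆ · ⋆ · ⋆ · tr_in ⟨a, p⟩))
                                (fn _ p => right_ p)))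
                (ho · ⋆ · ⋆ · ⋆ · u),
              fn u => hi · ⋆ · ⋆ · ⋆ · tr_bind
                (cases
                   (fn v => tr_bind (fn⟨a, p⟩ => tr_in ⟨cInl 0 · ⋆ · ⋆ · a, p⟩)
                              (ho · ⋆ · ⋆ · ⋆ · v))
                   (fn p => tr_in ⟨cInr 0 · ⋆ · ⋆ · cTt, p⟩)) u⟩⟩)).
Qed.

Lemma empty_unique : ⊢ forall_mem (fun m =>
  Π x : V, Π y : V, is_empty m x ~> is_empty m y ~> idV x y).
Proof.
  use extensionality.
  prove (fn ext m hp hi ho => fn x y hx hy => ext · m · hp · hi · ho · ⋆ · ⋆ · (fn z =>
    ⟨fn u => cIndEmpty 1 · (λ _ : cEmpty, m @ z @ y) · (hx · z · u),
     fn u => cIndEmpty 1 · (λ _ : cEmpty, m @ z @ x) · (hy · z · u)⟩)).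
Qed.

Lemma succ_unique : ⊢ forall_mem (fun m =>
  Π y : V, Π s : V, Π s' : V, is_succ m y s ~> is_succ m y s' ~> idV s s').
Proof.
  use extensionality.
  prove (fn ext m hp hi ho => fn y s s' h h' => ext · m · hp · hi · ho · ⋆ · ⋆ · (fn z =>
    ⟨fn u => snd_ (h' · z) · (fst_ (h · z) · u),
     fn u => snd_ (h · z) · (fst_ (h' · z) · u)⟩)).
Qed.

Definition numeral (e sc : stm) : stm :=
  cIndNat 1 @ (λ _ : cNat, V) @ e @ (λ _ : cNat, λ v : V, sc @ v).

(** Minimality is induction on the natural numbers: an inductive set contains
    some empty set and some successor of each member, and these are the numerals
    because they are unique. *)
Lemma numerals_inductive : ⊢ forall_mem (fun m => Π e : V, is_empty m e ~>
  Π sc : V ~> V, (Π y : V, is_succ m y (sc @ y)) ~> least_inductive m).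
Proof.
  use transp, sym, empty_unique, succ_unique.
  prove (fn transp sym empty_unique succ_unique m hp hi ho => fn e he sc hsc =>
    tr_in ⟨(cSet 0 @ cNat @ numeral e sc),
     ⟨⟨tr_in ⟨e, ⟨hi · ⋆ · ⋆ · ⋆ · tr_in ⟨cZero, rfl⟩, he⟩⟩,
       fn y u => tr_bind
         (fn⟨n, p⟩ => tr_in ⟨sc @ y,
            ⟨hi · ⋆ · ⋆ · ⋆ · tr_in ⟨cSucc @ n,
               transp · ⋆ · (λ w : V, idV (sc @ y) (sc @ w)) · ⋆ · ⋆ · p · rfl⟩,
             hsc · y⟩⟩)
         (ho · ⋆ · ⋆ · ⋆ · u)⟩,
      fn b hb z u => tr_rec (hp · ⋆ · ⋆)
        (fn⟨n, p⟩ =>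
           transp · ⋆ · (λ w : V, m @ w @ b) · ⋆ · ⋆ · (sym · ⋆ · ⋆ · ⋆ · p)
             · (cIndNat 1 · (λ n : cNat, m @ (numeral e sc @ n) @ b)
                  · tr_rec (hp · ⋆ · ⋆)
                      (fn⟨e', q⟩ => transp · ⋆ · (λ w : V, m @ w @ b) · ⋆ · ⋆
                         · (empty_unique · m · hp · hi · ho · ⋆ · ⋆ · snd_ q · he) · fst_ q)
                      (fst_ hb)
                  · (fn n v => tr_rec (hp · ⋆ · ⋆)
                      (fn⟨s, q⟩ => transp · ⋆ · (λ w : V, m @ w @ b) · ⋆ · ⋆
                         · (succ_unique · m · hp · hi · ho · ⋆ · ⋆ · ⋆ · snd_ q · (hsc · ⋆))
                         · fst_ q)
                      (snd_ hb · ⋆ · v))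
                  · n))
        (ho · ⋆ · ⋆ · ⋆ · u)⟩⟩).
Qed.

Lemma strong_infinity : ⊢ forall_mem least_inductive.
Proof.
  use numerals_inductive, successor, empty_set, choice.
  prove (fn inductive succ emp choice m hp hi ho =>
    tr_bind (fn⟨e, he⟩ =>
        unpack (choice · V · (λ _ : V, V) · (λ y : V, λ s : V, is_succ m y s)
                  · (succ · m · hp · hi · ho))
          (fn sc hsc => inductive · m · hp · hi · ho · e · he · sc · hsc))
      (emp · m · hp · hi · ho)).
Qed.

(** * Injective presentations and union *)

Definition mono (A g : stm) : stm :=
  Π x : A, Π y : A, idV (g @ x) (g @ y) ~> tId 0 A x y.
Definition presents (v A g : stm) : stm := prod 1 (mono A g) (idV v (cSet 0 @ A @ g)).
Definition pres_on (v A : stm) : stm := sig 1 (A ~> V) (fun g => presents v A g).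
Definition pres (v : stm) : stm := sig 1 (U 0) (fun A => pres_on v A).
Definition mk_pres (v A g r : stm) : stm :=
  pair 1 (U 0) (fun A => pres_on v A) A (pair 1 (A ~> V) (fun g => presents v A g) g r).

(** Identity in [A] is equivalent to the small proposition [g x = g y]. *)
Lemma mono_set : ⊢ forall_mem (fun m => Π A : U 0, Π g : A ~> V, mono A g ~> isSet 0 A).
Proof.
  use small_eq, resize_spec.
  prove (fn small_eq spec m hp hi ho => fn A g hg =>
    have s := (small_eq · m · hp · hi · ho ::: Π x : V, Π y : V, isSmall (idV x y));
    set_of_rel 0 · A
      · (λ x : A, λ y : A, resize (idV (g @ x) (g @ y)) (s @ (g @ x) @ (g @ y)))
      · (fn x y => res_prop (spec · ⋆ · (s @ (g @ x) @ (g @ y))))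
      · (fn x => res_in (spec · ⋆ · (s @ (g @ x) @ (g @ x))) · rfl)
      · (fn x y r => hg · x · y · (res_out (spec · ⋆ · (s @ (g @ x) @ (g @ y))) · r))).
Qed.

Lemma isProp_presents : ⊢ forall_mem (fun m =>
  Π v : V, Π A : U 0, Π g : A ~> V, isProp 1 (presents v A g)).
Proof.
  use mono_set, isProp_of_inhab, isProp_and, isProp_pi, isProp_raise.
  prove (fn mono_set isProp_of_inhab isProp_and isProp_pi isProp_raise m hp hi ho => fn v A g =>
    isProp_of_inhab · ⋆ · (fn⟨hg, _⟩ =>
      isProp_and · ⋆ · ⋆
        · (isProp_pi · ⋆ · ⋆ · (fn x => isProp_pi · ⋆ · ⋆ · (fn y => isProp_pi · ⋆ · ⋆ · (fn _ =>
             isProp_raise · ⋆ · (mono_set · m · hp · hi · ho · A · g · hg · x · y)))))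
        · (cVSet 0 · ⋆ · ⋆))).
Qed.

Definition coe (A B p : stm) : stm :=
  pr1 0 (A ~> B) (fun k => isequiv 0 A B k) (idtoeqv 0 A B @ p).

(** Univalence, with the computation rule of transport along the path. *)
Lemma ua_equiv : ⊢ Π A : U 0, Π B : U 0, Π e : equiv 0 A B,
  sig 1 (tId 1 (U 0) A B) (fun p => Π a : A,
    tId 0 B (coe A B p @ a) (pr1 0 (A ~> B) (fun k => isequiv 0 A B k) e @ a)).
Proof.
  prove (fn A B e =>
    let fwd e := pr1 0 (A ~> B) (fun k => isequiv 0 A B k) e in
    unpack (cUnivalence 0 · A · B) (fn R _ => unpack R (fn h hh =>
      ⟨h @ e,
       cIndId 1 1 · (equiv 0 A B)
         · (λ e : equiv 0 A B, λ e' : equiv 0 A B, λ _ : tId 1 (equiv 0 A B) e e',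
              Π a : A, tId 0 B (fwd e @ a) (fwd e' @ a))
         · (fn e a => cRefl 0 · ⋆ · ⋆) · ⋆ · ⋆ · (hh · e)⟩))).
Qed.

Lemma ua : ⊢ Π A : U 0, Π B : U 0, Π f : A ~> B, Π g : B ~> A,
  (Π b : B, tId 0 B (f @ (g @ b)) b) ~> (Π a : A, tId 0 A (g @ (f @ a)) a) ~>
  sig 1 (tId 1 (U 0) A B) (fun p => Π a : A, tId 0 B (coe A B p @ a) (f @ a)).
Proof.
  use ua_equiv.
  prove (fn ua_equiv A B f g h k => ua_equiv · A · B · (cPair 0 · ⋆ · ⋆ · f
    · (cPair 0 · ⋆ · ⋆ · (cPair 0 · ⋆ · ⋆ · g · h) · (cPair 0 · ⋆ · ⋆ · g · k)))).
Qed.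

(** By path induction, since [coe A A refl a] is [a]. *)
Lemma pres_path : ⊢ forall_mem (fun m => Π v : V, Π A : U 0, Π B : U 0,
  Π p : tId 1 (U 0) A B, Π g : A ~> V, Π h : B ~> V,
  (Π a : A, idV (g @ a) (h @ (coe A B p @ a))) ~>
  Π r : presents v A g, Π r' : presents v B h,
  tId 1 (pres v) (mk_pres v A g r) (mk_pres v B h r')).
Proof.
  use isProp_presents, subtype_path, ap_path, fun_ext.
  prove (fn isProp_presents subtype_path ap_path fun_ext m hp hi ho => fn v =>
    cIndId 1 1 · ⋆ · ⋆ · (fn A g h e r r' =>
      ap_path · ⋆ · ⋆ · (λ s : pres_on v A, pair 1 (U 0) (fun A => pres_on v A) A s) · ⋆ · ⋆
        · (subtype_path · ⋆ · ⋆ · (isProp_presents · m · hp · hi · ho · v · A) · ⋆ · ⋆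
             · (fun_ext · ⋆ · ⋆ · g · h · e) · r · r'))).
Qed.

(** The fibres of an injective presentation are propositions, so that [b] with
    [g a = h b] can be extracted from the truncation. *)
Lemma fiber_map : ⊢ forall_mem (fun m => Π v : V,
  Π A : U 0, Π g : A ~> V, Π B : U 0, Π h : B ~> V,
  presents v A g ~> presents v B h ~>
  sig 1 (A ~> B) (fun e => Π a : A, idV (g @ a) (h @ (e @ a)))).
Proof.
  use choice, subtype_path, transp, sym, trans, id_raise.
  prove (fn choice subtype_path transp sym trans id_raise m hp hi ho => fn v A g B h r r' =>
    choice · A · (λ _ : A, B) · (λ a : A, λ b : B, idV (g @ a) (h @ b))
      · (fn a => tr_rec
           (fn⟨b, p⟩ => fn⟨b', p'⟩ =>
              subtype_path · ⋆ · ⋆ · (fn b => cVSet 0 · ⋆ · ⋆) · ⋆ · ⋆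
                · (id_raise · ⋆ · ⋆ · ⋆ · (fst_ r' · ⋆ · ⋆
                     · (trans · ⋆ · ⋆ · ⋆ · ⋆ · (sym · ⋆ · ⋆ · ⋆ · p) · p')))
                · p · p')
           (fn x => x)
           (ho · ⋆ · ⋆ · ⋆ · (transp · ⋆ · (m @ (g @ a)) · ⋆ · ⋆ · snd_ r'
              · (transp · ⋆ · (m @ (g @ a)) · ⋆ · ⋆ · (sym · ⋆ · ⋆ · ⋆ · snd_ r)
                   · (hi · ⋆ · ⋆ · ⋆ · tr_in ⟨a, rfl⟩)))))).
Qed.

(** The maps between two presentations obtained from [fiber_map] are inverse to
    each other, so univalence identifies the index types. *)
Lemma isProp_pres : ⊢ forall_mem (fun m => Π v : V, isProp 1 (pres v)).
Proof.
  use pres_path, ua, fiber_map, sym, trans, transp, id_raise.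
  prove (fn pres_path ua fiber_map sym trans transp id_raise m hp hi ho => fn v =>
    split_ (fn A => fn⟨g, r⟩ => split_ (fn B => fn⟨h, r'⟩ =>
      unpack (fiber_map · m · hp · hi · ho · v · A · g · B · h · r · r') (fn e he =>
      unpack (fiber_map · m · hp · hi · ho · v · B · h · A · g · r' · r) (fn d hd =>
      unpack (ua · A · B · e · d
                · (fn b => fst_ r' · ⋆ · ⋆ · (sym · ⋆ · ⋆ · ⋆
                     · (trans · ⋆ · ⋆ · ⋆ · ⋆ · (hd · b) · (he · ⋆))))
                · (fn a => fst_ r · ⋆ · ⋆ · (sym · ⋆ · ⋆ · ⋆
                     · (trans · ⋆ · ⋆ · ⋆ · ⋆ · (he · a) · (hd · ⋆)))))
        (fn p hp' => pres_path · m · hp · hi · ho · v · A · B · p · g · h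
           · (fn a => transp · ⋆ · (λ b : B, idV (g @ a) (h @ b)) · ⋆ · ⋆
                · (sym · ⋆ · ⋆ · ⋆ · (id_raise · ⋆ · ⋆ · ⋆ · (hp' · a))) · (he · a))
           · r · r')))))).
Qed.

Definition quo_map (A f R q : stm) : stm :=
  cIndQuo 0 1 @ A @ R @ (λ _ : cQuo 0 @ A @ R, V) @ (λ _ : cQuo 0 @ A @ R, cVSet 0) @ f @ q.

Lemma quo_map_respects : ⊢ Π A : U 0, Π f : A ~> V, Π R : A ~> A ~> U 0,
  (Π a : A, Π b : A, R @ a @ b ~> idV (f @ a) (f @ b)) ~>
  Π a : A, Π b : A, Π r : R @ a @ b,
    pathover 0 1 (cQuo 0 @ A @ R) (λ _ : cQuo 0 @ A @ R, V)
      (cQuoIn 0 @ A @ R @ a) (cQuoIn 0 @ A @ R @ b) (cQuoPath 0 @ A @ R @ a @ b @ r)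
      (f @ a) (f @ b).
Proof.
  use trans.
  prove (fn trans A f R h a b r => trans · ⋆ · ⋆ · ⋆ · ⋆
    · (transport_const 0 1 (cQuo 0 @ A @ R) V · ⋆ · ⋆
         · (cQuoPath 0 · ⋆ · ⋆ · a · b · r) · (f @ a))
    · (h · a · b · r)).
Qed.

(** On the quotient of [A] by [R] the map induced by [f] is injective, and it has
    the same image. *)
Lemma image_presentation : ⊢ Π A : U 0, Π f : A ~> V, Π R : A ~> A ~> U 0,
  (Π a : A, Π b : A, R @ a @ b ~> idV (f @ a) (f @ b)) ~>
  (Π a : A, Π b : A, idV (f @ a) (f @ b) ~> R @ a @ b) ~> pres (cSet 0 @ A @ f).
Proof.
  use quo_map_respects, quo_prop_ind, isProp_pi, isProp_raise.
  prove (fn quo_map_respects quo_prop_ind isProp_pi isProp_raise A f R k l =>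
    have q := quo_map_respects · A · f · R · k;
    let X : stm := cQuo 0 @ A @ R in
    let g := quo_map A f R q in
    have set := ((fn x y => isProp_raise · ⋆ · (cQuoSet 0 · ⋆ · ⋆ · x · y))
                  ::: Π x : X, Π y : X, isProp 1 (tId 0 X x y));
    ⟨X, ⟨g,
      ⟨quo_prop_ind · A · R · ⋆
         · (fn x => isProp_pi · ⋆ · ⋆ · (fn y => isProp_pi · ⋆ · ⋆ · (fn _ => set · ⋆ · ⋆)))
         · (fn a => quo_prop_ind · A · R · ⋆
              · (fn y => isProp_pi · ⋆ · ⋆ · (fn _ => set · ⋆ · ⋆))
              · (fn b p => cQuoPath 0 · A · R · a · b · (l · a · b · p))),
       cSetExt 0 · A · X · f · g ·
         ⟨fn a => tr_in ⟨cQuoIn 0 @ A @ R @ a, rfl⟩,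
          quo_prop_ind · A · R · ⋆ · (fn x => cTrPath 1 · ⋆) · (fn a => tr_in ⟨a, rfl⟩)⟩⟩⟩⟩).
Qed.

Lemma presentation : ⊢ forall_mem (fun m => Π v : V, pres v).
Proof.
  use V_prop_ind, isProp_pres, small_eq, resize_spec, image_presentation.
  prove (fn V_prop_ind isProp_pres small_eq spec image_presentation m hp hi ho =>
    have s := (small_eq · m · hp · hi · ho ::: Π x : V, Π y : V, isSmall (idV x y));
    V_prop_ind · ⋆ · (isProp_pres · m · hp · hi · ho) · (fn A f _ =>
      image_presentation · A · f
        · (λ a : A, λ b : A, resize (idV (f @ a) (f @ b)) (s @ (f @ a) @ (f @ b)))
        · (fn a b => res_out (spec · ⋆ · (s @ (f @ a) @ (f @ b))))
        · (fn a b => res_in (spec · ⋆ · (s @ (f @ a) @ (f @ b)))))).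
Qed.

Lemma presentations : ⊢ forall_mem (fun m => Π A : U 0, Π f : A ~> V,
  sig 1 (A ~> U 0) (fun T => sig 1 (Π a : A, T @ a ~> V) (fun G =>
    Π a : A, idV (f @ a) (cSet 0 @ (T @ a) @ (G @ a))))).
Proof.
  use presentation, choice.
  prove (fn presentation choice m hp hi ho => fn A f =>
    unpack (choice · A · (λ _ : A, U 0) · (λ a : A, λ T : U 0, pres_on (f @ a) T)
              · (fn a => presentation · m · hp · hi · ho · (f @ a))) (fn T D =>
    unpack (choice · A · (λ a : A, T @ a ~> V)
              · (λ a : A, λ g : (T @ a ~> V), presents (f @ a) (T @ a) g) · D) (fn G e =>
      ⟨T, ⟨G, fn a => snd_ (e · a)⟩⟩))).
Qed.

(** A member of [f a] is the value at some [t : T a] of the presentation of [f a]. *)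
Lemma union : ⊢ forall_mem (fun m => Π y : V, ex 1 V (fun w => Π x : V,
  biimp (m @ x @ w) (ex 1 V (fun u => prod 1 (m @ u @ y) (m @ x @ u))))).
Proof.
  use V_prop_ind, presentations, transp, sym.
  prove (fn V_prop_ind presentations transp sym m hp hi ho =>
    V_prop_ind · ⋆ · (fn y => cTrPath 1 · ⋆) · (fn A f _ =>
      unpack (presentations · m · hp · hi · ho · A · f) (fn T D => unpack D (fn G e =>
        let T' a := (T @ a)%hott in
        tr_in ⟨(cSet 0 @ sig 0 A T' @ (λ s : sig 0 A T', G @ pr1 0 A T' s @ pr2 0 A T' s)),
          fn x =>
            ⟨fn u => tr_bind
               (split_ (cIndSig 0 1 · ⋆ · ⋆ · ⋆ · (fn a t p => tr_in ⟨f @ a,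
                  ⟨hi · ⋆ · ⋆ · ⋆ · tr_in ⟨a, rfl⟩,
                   transp · ⋆ · (m @ x) · ⋆ · ⋆ · (sym · ⋆ · ⋆ · ⋆ · (e · a))
                     · (hi · ⋆ · ⋆ · ⋆ · tr_in ⟨t, p⟩)⟩⟩)))
               (ho · ⋆ · ⋆ · ⋆ · u),
             fn k => hi · ⋆ · ⋆ · ⋆ · tr_bind
               (fn⟨u, r⟩ => tr_bind
                  (fn⟨a, p⟩ => tr_bind
                     (fn⟨t, q⟩ => tr_in ⟨cPair 0 · ⋆ · (λ a : A, T @ a) · a · t, q⟩)
                     (ho · ⋆ · ⋆ · ⋆ · (transp · ⋆ · (m @ x) · ⋆ · ⋆ · (e · a)
                        · (transp · ⋆ · (m @ x) · ⋆ · ⋆ · p · snd_ r))))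
                  (ho · ⋆ · ⋆ · ⋆ · fst_ r)) k⟩⟩)))).
Qed.

(** * The membership relation *)

(** The term [mem 0] at binding depth [0], sealed: its definition has tens of
    thousands of nodes, and conversion must not unfold it. *)
Lemma sealed_mem : {M : tm | M = mem 0 0}.
Proof. exists (mem 0 0). reflexivity. Qed.
Definition Mem : tm := proj1_sig sealed_mem.
Lemma Mem_eq : Mem = mem 0 0.
Proof. exact (proj2_sig sealed_mem). Qed.
Definition mem0 : stm := fun _ => Mem.

(** A closed [stm] does not depend on the depth; the recursion of subtraction
    makes two successive depths convertible. *)
Lemma mem_depth n : mem 0 n = Mem.
Proof. rewrite Mem_eq. induction n as [|n IH]; [reflexivity|]. rewrite <- IH. reflexivity. Qed.

Lemma Mem_type Γ : has_type Γ Mem (closed_tm (V ~> V ~> U 1)%hott).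
Proof. rewrite Mem_eq. by_check. Qed.
Lemma Mem_scoped : scoped 0 Mem = true.
Proof. rewrite Mem_eq. vm_compute. reflexivity. Qed.
Lemma subst_Mem s : subst s Mem = Mem.
Proof. apply subst_closed, Mem_scoped. Qed.
Lemma ren_Mem r : ren r Mem = Mem.
Proof. apply ren_closed, Mem_scoped. Qed.

(** [x ∈ set A f] reduces to its defining clause. *)
Lemma mem0_intro : ⊢ mem_intro mem0.
Proof. unfold mem0. rewrite Mem_eq. prove (fn x A f u => u). Qed.
Lemma mem0_elim : ⊢ mem_elim mem0.
Proof. unfold mem0. rewrite Mem_eq. prove (fn x A f u => u). Qed.

Definition mem_prop_on_set (m : stm) : stm :=
  Π x : V, Π A : U 0, Π f : A ~> V, isProp 1 (m @ x @ (cSet 0 @ A @ f)).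

Lemma mem0_prop_on_set : ⊢ mem_prop_on_set mem0.
Proof. unfold mem0. rewrite Mem_eq. prove (fn x A f => cTrPath 1 · ⋆). Qed.

Lemma isProp_isProp1 : ⊢ Π A : U 1, isProp 1 (isProp 1 A).
Proof. prove (isProp_isProp 1). Qed.

Lemma mem_prop_of_set : ⊢ Π m : V ~> V ~> U 1, mem_prop_on_set m ~> mem_prop m.
Proof.
  use V_prop_ind, isProp_isProp1.
  prove (fn V_prop_ind isProp_isProp1 m h x =>
    V_prop_ind · ⋆ · (fn y => isProp_isProp1 · ⋆) · (fn A f _ => h · x · A · f)).
Qed.

Ltac simp_Mem := cbn; unfold lift; cbn; rewrite ?ren_Mem, ?subst_Mem.

Lemma mem0_prop : ⊢ mem_prop mem0.
Proof.
  destruct mem0_prop_on_set as [h H].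
  assert (G : inh [] (mem_prop mem0 0)); [|exact G].
  start mem_prop_of_set. inst H0 ltac:(apply Mem_type). inst H0 ltac:(simp_Mem; exact H).
  eexists. revert H0. simp_Mem. intros H0. exact H0.
Qed.

(** The terms substituted for the proofs of the three laws disappear because a
    statement [T m] does not mention them. *)
Definition mem_instance (T : stm -> stm) : Prop := forall h1 h2 h3,
  subst (h3 .: h2 .: h1 .: Mem .: Var) (T (sVar 0) 4) = T mem0 0.

Lemma forall_mem_elim (T : stm -> stm) : mem_instance T -> (⊢ forall_mem T) -> ⊢ T mem0.
Proof.
  intros HT H. destruct mem0_prop as [h1 H1]. destruct mem0_intro as [h2 H2].
  destruct mem0_elim as [h3 H3].
  assert (G : inh [] (T mem0 0)); [|exact G].
  start H. inst H0 ltac:(apply Mem_type). inst H0 ltac:(simp_Mem; exact H1).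
  inst H0 ltac:(simp_Mem; exact H2). inst H0 ltac:(simp_Mem; exact H3).
  eexists. rewrite HT in H0. exact H0.
Qed.

Ltac mem_instance := intros h1 h2 h3; simp_Mem; reflexivity.

(** * Formulas as terms *)

(** In [denot p] every connective is a closed function applied to arguments, so
    no weakening occurs and lemmas about the connectives apply by instantiation
    alone.  Only at the end is it converted to the translation in which these
    functions are reduced. *)
Definition not_fn : stm := λ P : U 1, P ~> cEmpty.
Definition imp_fn : stm := λ P : U 1, λ Q : U 1, P ~> Q.
Definition and_fn : stm := λ P : U 1, λ Q : U 1, prod 1 P Q.
Definition or_fn : stm := λ P : U 1, λ Q : U 1, disj P Q.
Definition all_fn : stm := λ φ : V ~> U 1, Π x : V, φ @ x.
Definition ex_fn : stm := λ φ : V ~> U 1, ex 1 V (fun x => φ @ x).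

Definition tV : tm := Cst (cV 0).

Fixpoint denot (p : formula) : tm :=
  match p with
  | FEq x y => apps (Cst (cId 1)) [tV; Var x; Var y]
  | FMem x y => apps Mem [Var x; Var y]
  | FNot p => App (not_fn 0) (denot p)
  | FImp p q => apps (imp_fn 0) [denot p; denot q]
  | FAnd p q => apps (and_fn 0) [denot p; denot q]
  | FOr p q => apps (or_fn 0) [denot p; denot q]
  | FAll p => App (all_fn 0) (Lam tV (denot p))
  | FEx p => App (ex_fn 0) (Lam tV (denot p))
  end.

Definition family (p : formula) : tm := Lam tV (denot p).

Definition Vs (n : nat) : list tm := repeat tV n.

Lemma has_type_V Γ k : nth_error Γ k = Some tV -> has_type Γ (Var k) tV.
Proof. intros H. change tV with (ren (fun m => S k + m) tV). apply T_var, H. Qed.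

Lemma Vs_var n k : k < n -> has_type (Vs n) (Var k) tV.
Proof. intros H. apply has_type_V, nth_error_repeat, H. Qed.

Lemma tV_type Γ : has_type Γ tV (Univ 1).
Proof. by_check. Qed.

Lemma denot_type p : forall n, fv p <= n -> has_type (Vs n) (denot p) (Univ 1).
Proof.
  assert (H1 : forall Γ f a, has_type Γ f (Pi (Univ 1) (Univ 1)) ->
            has_type Γ a (Univ 1) -> has_type Γ (App f a) (Univ 1)).
  { intros. eapply (T_app _ (Univ 1) (Univ 1)); eassumption. }
  assert (H2 : forall Γ f a b, has_type Γ f (Pi (Univ 1) (Pi (Univ 1) (Univ 1))) ->
            has_type Γ a (Univ 1) -> has_type Γ b (Univ 1) ->
            has_type Γ (apps f [a; b]) (Univ 1)).
  { intros. apply H1; [|assumption].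
    eapply (T_app _ (Univ 1) (Pi (Univ 1) (Univ 1))); eassumption. }
  induction p; intros n Hn; cbn [fv] in Hn; cbn [denot].
  - pose proof (inst_const (Vs n) (cId 1)) as H. inst H ltac:(apply tV_type).
    inst H ltac:(apply Vs_var with (k := x); lia).
    inst H ltac:(apply Vs_var with (k := y); lia). exact H.
  - apply (T_app _ tV (Univ 1)); [|apply Vs_var; lia].
    apply (T_app _ tV (Pi tV (Univ 1))); [apply Mem_type | apply Vs_var; lia].
  - apply H1; [by_check | apply IHp; lia].
  - apply H2; [by_check | apply IHp1; lia | apply IHp2; lia].
  - apply H2; [by_check | apply IHp1; lia | apply IHp2; lia].
  - apply H2; [by_check | apply IHp1; lia | apply IHp2; lia].
  - eapply (T_app _ (Pi tV (Univ 1)) (Univ 1)); [by_check|].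
    eapply T_lam; [apply tV_type | apply (IHp (S n)); lia].
  - eapply (T_app _ (Pi tV (Univ 1)) (Univ 1)); [by_check|].
    eapply T_lam; [apply tV_type | apply (IHp (S n)); lia].
Qed.

Lemma family_type p n : fv p <= S n -> has_type (Vs n) (family p) (Pi tV (Univ 1)).
Proof. intros H. eapply T_lam; [apply tV_type | apply (denot_type p (S n)), H]. Qed.

Lemma conv_family p : conv (App (lift (family p)) (Var 0)) (denot p).
Proof.
  eapply conv_trans; [apply conv_beta|]. apply conv_of_eq.
  unfold subst1. rewrite subst_ren. apply subst_var. intros [|n]; reflexivity.
Qed.

Lemma denot_fren p : forall r, denot (fren r p) = ren r (denot p).
Proof. induction p; intros r; cbn; rewrite ?ren_Mem; repeat f_equal; auto. Qed.

(** [on_V F] is the term of [λ φ, Π x : V, F (φ x)]. *)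
Definition on_V (F : tm) : tm :=
  Lam (Pi tV (Univ 1)) (Pi tV (App F (App (Var 1) (Var 0)))).

(** The conversion turns a proof about the open term [denot p] into one about its
    abstraction, the form in which lemmas on quantifiers expect it. *)
Lemma inh_family Γ F p : scoped 0 F = true ->
  has_type Γ (on_V F) (Pi (Pi tV (Univ 1)) (Univ 1)) ->
  has_type Γ (family p) (Pi tV (Univ 1)) ->
  inh (tV :: Γ) (App F (denot p)) -> inh Γ (App (on_V F) (family p)).
Proof.
  intros HF HV Hp [t Ht]. exists (Lam tV t). eapply T_conv with (i := 1).
  - eapply T_lam; [apply tV_type | exact Ht].
  - apply conv_sym. eapply conv_trans; [apply conv_beta|].
    unfold subst1. cbn [subst]. rewrite (subst_closed F) by exact HF.
    apply conv_pi; [apply conv_refl|].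
    apply conv_app; [apply conv_refl | apply conv_family].
  - eapply (T_app _ (Pi tV (Univ 1)) (Univ 1)); [exact HV | exact Hp].
Qed.

(** * Formulas denote propositions, and bounded formulas small ones *)

Definition isProp_fn : stm := λ P : U 1, isProp 1 P.
Definition isSmall_fn : stm := λ P : U 1, isSmall P.
Definition props_fn : stm := λ φ : V ~> U 1, Π x : V, isProp_fn @ (φ @ x).
Definition smalls_fn : stm := λ φ : V ~> U 1, Π x : V, isSmall_fn @ (φ @ x).

Lemma denot_isProp_eq : ⊢ Π x : V, Π y : V, isProp_fn @ tId 1 V x y.
Proof. prove (cVSet 0). Qed.

Lemma denot_isProp_mem : ⊢ Π x : V, Π y : V, isProp_fn @ (mem0 @ x @ y).
Proof.
  refine (forall_mem_elim (fun m => Π x : V, Π y : V, isProp_fn @ (m @ x @ y))%hott _ _);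
    [mem_instance|].
  prove (fn m hp hi ho => hp).
Qed.

Lemma denot_isProp_not : ⊢ Π P : U 1, isProp_fn @ (not_fn @ P).
Proof.
  use isProp_pi, isProp_empty.
  prove (fn isProp_pi isProp_empty P =>
    isProp_pi · P · (λ _ : P, cEmpty) · (fn _ => isProp_empty)).
Qed.

Lemma denot_isProp_imp : ⊢ Π P : U 1, Π Q : U 1, (isProp_fn @ Q) ~> isProp_fn @ (imp_fn @ P @ Q).
Proof.
  use isProp_pi.
  prove (fn isProp_pi P Q h => isProp_pi · P · (λ _ : P, Q) · (fn _ => h)).
Qed.

Lemma denot_isProp_and : ⊢ Π P : U 1, Π Q : U 1,
  (isProp_fn @ P) ~> (isProp_fn @ Q) ~> isProp_fn @ (and_fn @ P @ Q).
Proof. use isProp_and. prove (fn isProp_and => isProp_and). Qed.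

Lemma denot_isProp_or : ⊢ Π P : U 1, Π Q : U 1, isProp_fn @ (or_fn @ P @ Q).
Proof. prove (fn P Q => cTrPath 1 · (cSum 1 @ P @ Q)). Qed.

Lemma denot_isProp_all : ⊢ Π φ : V ~> U 1, (props_fn @ φ) ~> isProp_fn @ (all_fn @ φ).
Proof. use isProp_pi. prove (fn isProp_pi => isProp_pi · V). Qed.

Lemma denot_isProp_ex : ⊢ Π φ : V ~> U 1, isProp_fn @ (ex_fn @ φ).
Proof. prove (fn φ => cTrPath 1 · sig 1 V (fun x => φ @ x)). Qed.

Lemma denot_isProp p : forall n, fv p <= n -> inh (Vs n) (App (isProp_fn 0) (denot p)).
Proof.
  induction p; intros n Hn; cbn [fv] in Hn; cbn [denot].
  - start denot_isProp_eq. inst H ltac:(apply Vs_var with (k := x); lia).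
    inst H ltac:(apply Vs_var with (k := y); lia). eexists. exact H.
  - start denot_isProp_mem. inst H ltac:(apply Vs_var with (k := x); lia).
    inst H ltac:(apply Vs_var with (k := y); lia). eexists.
    revert H. simp_Mem. intros H. exact H.
  - start denot_isProp_not. inst H ltac:(apply (denot_type p); lia). eexists. exact H.
  - destruct (IHp2 n) as [t Ht]; [lia|].
    start denot_isProp_imp. inst H ltac:(apply (denot_type p1); lia).
    inst H ltac:(apply (denot_type p2); lia). inst H ltac:(exact Ht). eexists. exact H.
  - destruct (IHp1 n) as [t Ht]; [lia|]. destruct (IHp2 n) as [u Hu]; [lia|].
    start denot_isProp_and. inst H ltac:(apply (denot_type p1); lia).
    inst H ltac:(apply (denot_type p2); lia). inst H ltac:(exact Ht).
    inst H ltac:(exact Hu). eexists. exact H.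
  - start denot_isProp_or. inst H ltac:(apply (denot_type p1); lia).
    inst H ltac:(apply (denot_type p2); lia). eexists. exact H.
  - destruct (inh_family (Vs n) (isProp_fn 0) p) as [t Ht];
      [reflexivity | by_check | apply family_type; lia | apply (IHp (S n)); lia |].
    start denot_isProp_all. inst H ltac:(apply (family_type p); lia).
    inst H ltac:(exact Ht). eexists. exact H.
  - start denot_isProp_ex. inst H ltac:(apply (family_type p); lia). eexists. exact H.
Qed.

Lemma denot_props p n : fv p <= S n -> inh (Vs n) (App (props_fn 0) (family p)).
Proof.
  intros Hp. apply (inh_family _ (isProp_fn 0)); [reflexivity | by_check | |].
  - apply family_type, Hp.
  - apply (denot_isProp p (S n)), Hp.
Qed.

Lemma denot_isSmall_eq : ⊢ Π x : V, Π y : V, isSmall_fn @ tId 1 V x y.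
Proof.
  refine (forall_mem_elim (fun _ => Π x : V, Π y : V, isSmall_fn @ tId 1 V x y)%hott _ _);
    [mem_instance|].
  use small_eq. prove (fn small_eq => small_eq).
Qed.

Lemma denot_isSmall_mem : ⊢ Π x : V, Π y : V, isSmall_fn @ (mem0 @ x @ y).
Proof.
  refine (forall_mem_elim (fun m => Π x : V, Π y : V, isSmall_fn @ (m @ x @ y))%hott _ _);
    [mem_instance|].
  use small_mem. prove (fn small_mem => small_mem).
Qed.

Lemma denot_isSmall_not : ⊢ Π P : U 1, (isSmall_fn @ P) ~> isSmall_fn @ (not_fn @ P).
Proof.
  use small_imp, small_empty.
  prove (fn small_imp small_empty P h => small_imp · P · cEmpty · h · small_empty).
Qed.

Lemma denot_isSmall_imp : ⊢ Π P : U 1, Π Q : U 1,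
  (isSmall_fn @ P) ~> (isSmall_fn @ Q) ~> isSmall_fn @ (imp_fn @ P @ Q).
Proof. use small_imp. prove (fn small_imp => small_imp). Qed.

Lemma denot_isSmall_and : ⊢ Π P : U 1, Π Q : U 1,
  (isSmall_fn @ P) ~> (isSmall_fn @ Q) ~> isSmall_fn @ (and_fn @ P @ Q).
Proof. use small_and. prove (fn small_and => small_and). Qed.

Lemma denot_isSmall_or : ⊢ Π P : U 1, Π Q : U 1,
  (isSmall_fn @ P) ~> (isSmall_fn @ Q) ~> isSmall_fn @ (or_fn @ P @ Q).
Proof. use small_or. prove (fn small_or => small_or). Qed.

Lemma denot_isSmall_ball : ⊢ Π φ : V ~> U 1, (props_fn @ φ) ~> (smalls_fn @ φ) ~>
  Π y : V, isSmall_fn @ (all_fn @ λ x : V, imp_fn @ (mem0 @ x @ y) @ (φ @ x)).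
Proof.
  refine (forall_mem_elim (fun m => Π φ : V ~> U 1, (props_fn @ φ) ~> (smalls_fn @ φ) ~>
    Π y : V, isSmall_fn @ (all_fn @ λ x : V, imp_fn @ (m @ x @ y) @ (φ @ x)))%hott _ _);
    [mem_instance|].
  use small_ball. prove (fn small_ball => small_ball).
Qed.

Lemma denot_isSmall_bex : ⊢ Π φ : V ~> U 1, (smalls_fn @ φ) ~>
  Π y : V, isSmall_fn @ (ex_fn @ λ x : V, and_fn @ (mem0 @ x @ y) @ (φ @ x)).
Proof.
  refine (forall_mem_elim (fun m => Π φ : V ~> U 1, (smalls_fn @ φ) ~>
    Π y : V, isSmall_fn @ (ex_fn @ λ x : V, and_fn @ (m @ x @ y) @ (φ @ x)))%hott _ _);
    [mem_instance|].
  use small_bex. prove (fn small_bex => small_bex).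
Qed.

Lemma denot_smalls p n : fv p <= S n -> inh (Vs (S n)) (App (isSmall_fn 0) (denot p)) ->
  inh (Vs n) (App (smalls_fn 0) (family p)).
Proof.
  intros Hp H. apply (inh_family _ (isSmall_fn 0)); [reflexivity | by_check | | exact H].
  apply family_type, Hp.
Qed.

Lemma denot_isSmall p : Delta0 p ->
  forall n, fv p <= n -> inh (Vs n) (App (isSmall_fn 0) (denot p)).
Proof.
  induction 1 as [x y|x y|p D IH|p q D1 IH1 D2 IH2|p q D1 IH1 D2 IH2|p q D1 IH1 D2 IH2
                 |y p D IH|y p D IH]; intros n Hn.
  - cbn [fv denot] in *. start denot_isSmall_eq.
    inst H ltac:(apply Vs_var with (k := x); lia).
    inst H ltac:(apply Vs_var with (k := y); lia). eexists. exact H.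
  - cbn [fv denot] in *. start denot_isSmall_mem.
    inst H ltac:(apply Vs_var with (k := x); lia).
    inst H ltac:(apply Vs_var with (k := y); lia). eexists.
    revert H. simp_Mem. intros H. exact H.
  - cbn [fv denot] in *. destruct (IH n) as [t Ht]; [lia|].
    start denot_isSmall_not. inst H ltac:(apply (denot_type p); lia).
    inst H ltac:(exact Ht). eexists. exact H.
  - cbn [fv denot] in *. destruct (IH1 n) as [t Ht]; [lia|]. destruct (IH2 n) as [u Hu]; [lia|].
    start denot_isSmall_imp. inst H ltac:(apply (denot_type p); lia).
    inst H ltac:(apply (denot_type q); lia). inst H ltac:(exact Ht).
    inst H ltac:(exact Hu). eexists. exact H.
  - cbn [fv denot] in *. destruct (IH1 n) as [t Ht]; [lia|]. destruct (IH2 n) as [u Hu]; [lia|].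
    start denot_isSmall_and. inst H ltac:(apply (denot_type p); lia).
    inst H ltac:(apply (denot_type q); lia). inst H ltac:(exact Ht).
    inst H ltac:(exact Hu). eexists. exact H.
  - cbn [fv denot] in *. destruct (IH1 n) as [t Ht]; [lia|]. destruct (IH2 n) as [u Hu]; [lia|].
    start denot_isSmall_or. inst H ltac:(apply (denot_type p); lia).
    inst H ltac:(apply (denot_type q); lia). inst H ltac:(exact Ht).
    inst H ltac:(exact Hu). eexists. exact H.
  - assert (Hy : y < n /\ fv p <= S n) by (cbn [fv FAllIn] in Hn; lia).
    destruct Hy as [Hy Hp]. destruct (denot_props p n Hp) as [t Ht].
    destruct (denot_smalls p n Hp (IH _ Hp)) as [u Hu].
    start denot_isSmall_ball. inst H ltac:(apply (family_type p); lia).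
    inst H ltac:(exact Ht). inst H ltac:(exact Hu).
    inst H ltac:(apply Vs_var with (k := y); lia). eexists.
    eapply T_conv with (i := 1).
    + cbn -[family] in H. unfold mem0 in H. rewrite !subst_Mem in H. exact H.
    + repeat first [apply conv_refl | apply conv_family | apply conv_lam | apply conv_app].
    + eapply (T_app _ (Univ 1) (Univ 1)); [by_check | apply denot_type, Hn].
  - assert (Hy : y < n /\ fv p <= S n) by (cbn [fv FExIn] in Hn; lia).
    destruct Hy as [Hy Hp].
    destruct (denot_smalls p n Hp (IH _ Hp)) as [u Hu].
    start denot_isSmall_bex. inst H ltac:(apply (family_type p); lia).
    inst H ltac:(exact Hu).
    inst H ltac:(apply Vs_var with (k := y); lia). eexists.
    eapply T_conv with (i := 1).
    + cbn -[family] in H. unfold mem0 in H. rewrite !subst_Mem in H. exact H.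
    + repeat first [apply conv_refl | apply conv_family | apply conv_lam | apply conv_app].
    + eapply (T_app _ (Univ 1) (Univ 1)); [by_check | apply denot_type, Hn].
Qed.

(** * From terms to the translation of formulas *)

(** [interp 0 p] as a term in the context of its free variables. *)
Fixpoint denot_nf (p : formula) : tm :=
  match p with
  | FEq x y => apps (Cst (cId 1)) [tV; Var x; Var y]
  | FMem x y => apps Mem [Var x; Var y]
  | FNot p => Pi (denot_nf p) (Cst cEmpty)
  | FImp p q => Pi (denot_nf p) (lift (denot_nf q))
  | FAnd p q => apps (Cst (cSig 1)) [denot_nf p; Lam (denot_nf p) (lift (denot_nf q))]
  | FOr p q => App (Cst (cTr 1)) (apps (Cst (cSum 1)) [denot_nf p; denot_nf q])
  | FAll p => Pi tV (denot_nf p)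
  | FEx p => App (Cst (cTr 1)) (apps (Cst (cSig 1)) [tV; Lam tV (denot_nf p)])
  end.

(** An environment is given as a renaming [r] that holds at all depths from [n]
    on, because below further binders the variables are looked up again. *)
Lemma interp_denot p : forall e n r,
  (forall m, m < fv p -> forall k, e m (k + n) = Var (k + r m)) ->
  interp 0 p e n = ren r (denot_nf p).
Proof.
  assert (Hup : forall e n r N,
     (forall m, m < pred N -> forall k, e m (k + n) = Var (k + r m)) ->
     forall m, m < N -> forall k, scons (sVar n) e m (k + S n) = Var (k + upren r m)).
  { intros e n r N H [|m] Hm k; cbn [scons upren].
    - unfold sVar. f_equal. lia.
    - rewrite <- Nat.add_succ_comm, H by lia. f_equal. lia. }
  assert (Hs : forall e n r N, (forall m, m < N -> forall k, e m (k + n) = Var (k + r m)) ->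
     forall m, m < N -> forall k, e m (k + S n) = Var (k + S (r m))).
  { intros e n r N H m Hm k. rewrite <- Nat.add_succ_comm, H by lia. f_equal. lia. }
  induction p; intros e n r H; cbn [fv] in H.
  - pose proof (H x ltac:(lia) 0) as Hx. pose proof (H y ltac:(lia) 0) as Hy. cbn in *.
    unfold tId, sApp. rewrite Hx, Hy. reflexivity.
  - pose proof (H x ltac:(lia) 0) as Hx. pose proof (H y ltac:(lia) 0) as Hy.
    cbn -[mem] in *. unfold sApp. rewrite Hx, Hy, mem_depth, ren_Mem. reflexivity.
  - cbn. unfold sPi. rewrite (IHp _ _ r) by exact H. reflexivity.
  - cbn. unfold sPi, lift. rewrite ren_ren. rewrite (IHp1 _ _ r).
    + rewrite (IHp2 e (S n) (fun m => S (r m))); [reflexivity|].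
      apply (Hs e n r (fv p2)). intros; apply H; lia.
    + intros; apply H; lia.
  - cbn. unfold prod, sig, sPi, sApp, sLam, lift. cbn. rewrite ren_ren.
    rewrite !(IHp1 _ _ r).
    + rewrite (IHp2 e (S n) (fun m => S (r m))); [reflexivity|].
      apply (Hs e n r (fv p2)). intros; apply H; lia.
    + intros; apply H; lia.
  - cbn. unfold sApp. rewrite (IHp1 _ _ r), (IHp2 _ _ r) by (intros; apply H; lia).
    reflexivity.
  - cbn. unfold sPi. rewrite (IHp _ _ (upren r)); [reflexivity | apply Hup, H].
  - cbn. unfold ex, sig, sApp, sLam. cbn.
    rewrite (IHp _ _ (upren r)); [reflexivity | apply Hup, H].
Qed.

Lemma denot_conv p : conv (denot p) (denot_nf p).
Proof.
  assert (H2 : forall A B b a a' c c', conv a a' -> conv c c' ->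
    conv (apps (Lam A (Lam B b)) [a; c]) (subst1 c' (subst (upsub (a' .: Var)) b))).
  { intros A B b a a' c c' Ha Hc.
    eapply conv_trans; [apply conv_app; [apply conv_app; [apply conv_refl | exact Ha] | exact Hc]|].
    eapply conv_trans; [apply conv_app; [apply conv_beta | apply conv_refl]|].
    apply conv_beta. }
  induction p; cbn [denot denot_nf]; try apply conv_refl.
  - eapply conv_trans; [apply conv_app; [apply conv_refl | eassumption]|]. apply conv_beta.
  - eapply conv_trans; [apply H2; eassumption|]. apply conv_of_eq. cbn. unfold lift.
    repeat f_equal; rewrite subst_ren; apply subst_var; reflexivity.
  - eapply conv_trans; [apply H2; eassumption|]. apply conv_of_eq. cbn. unfold lift.
    repeat f_equal; rewrite subst_ren; apply subst_var; reflexivity.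
  - eapply conv_trans; [apply H2; eassumption|]. apply conv_of_eq. cbn. unfold lift.
    repeat f_equal; rewrite subst_ren; apply subst_var; reflexivity.
  - eapply conv_trans; [apply conv_beta|]. apply conv_pi; [apply conv_refl|].
    eapply conv_trans; [apply (conv_family p) | assumption].
  - eapply conv_trans; [apply conv_beta|]. apply conv_app; [apply conv_refl|].
    apply conv_app; [apply conv_refl|]. apply conv_lam; [apply conv_refl|].
    eapply conv_trans; [apply (conv_family p) | assumption].
Qed.

(** The renaming makes the induction pass through the weakenings in [denot_nf]. *)
Lemma denot_nf_type p : forall Γ r, (forall m, m < fv p -> nth_error Γ (r m) = Some tV) ->
  has_type Γ (ren r (denot_nf p)) (Univ 1).
Proof.
  assert (Hup : forall Γ r N, (forall m, m < pred N -> nth_error Γ (r m) = Some tV) ->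
     forall m, m < N -> nth_error (tV :: Γ) (upren r m) = Some tV).
  { intros Γ r N H [|m] Hm; cbn; [reflexivity | apply H; lia]. }
  assert (Hsig : forall Γ A B, has_type Γ A (Univ 1) -> has_type (A :: Γ) B (Univ 1) ->
     has_type Γ (apps (Cst (cSig 1)) [A; Lam A B]) (Univ 1)).
  { intros Γ A B HA HB. pose proof (inst_const Γ (cSig 1)) as H. inst H ltac:(exact HA).
    inst H ltac:(eapply T_lam; [exact HA | exact HB]). exact H. }
  assert (Htr : forall Γ A, has_type Γ A (Univ 1) -> has_type Γ (App (Cst (cTr 1)) A) (Univ 1)).
  { intros Γ A HA. pose proof (inst_const Γ (cTr 1)) as H. inst H ltac:(exact HA). exact H. }
  induction p; intros Γ r H; cbn [fv] in H; cbn; unfold lift; rewrite ?ren_ren, ?ren_Mem.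
  - pose proof (inst_const Γ (cId 1)) as H0. inst H0 ltac:(apply tV_type).
    inst H0 ltac:(apply (has_type_V _ (r x)), H; lia).
    inst H0 ltac:(apply (has_type_V _ (r y)), H; lia). exact H0.
  - apply (T_app _ tV (Univ 1)); [|apply has_type_V, H; lia].
    apply (T_app _ tV (Pi tV (Univ 1))); [apply Mem_type | apply has_type_V, H; lia].
  - apply T_pi; [apply IHp, H|]. apply (has_type_level _ _ 0); [lia|]. apply T_cst.
  - apply T_pi; [apply IHp1; intros; apply H; lia | apply IHp2; intros; apply H; lia].
  - apply Hsig; [apply IHp1; intros; apply H; lia | apply IHp2; intros; apply H; lia].
  - apply Htr. pose proof (inst_const Γ (cSum 1)) as H0.
    inst H0 ltac:(apply (IHp1 Γ r); intros; apply H; lia).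
    inst H0 ltac:(apply (IHp2 Γ r); intros; apply H; lia). exact H0.
  - apply T_pi; [apply tV_type|]. apply IHp. apply (Hup Γ r (fv p)), H.
  - apply Htr, Hsig; [apply tV_type|]. apply IHp. apply (Hup Γ r (fv p)), H.
Qed.

Lemma inh_closure n p : inh (Vs n) (denot_nf p) -> inh [] (denot_nf (Nat.iter n FAll p)).
Proof.
  revert p; induction n as [|n IH]; intros p H; [exact H|].
  rewrite Nat.iter_succ_r. apply IH. destruct H as [t Ht]. exists (Lam tV t).
  eapply T_lam; [apply tV_type | exact Ht].
Qed.

Lemma fv_closure p : fv (closure p) = 0.
Proof.
  unfold closure. enough (H : forall n, fv (Nat.iter n FAll p) = fv p - n) by (rewrite H; lia).
  induction n as [|n IH]; [cbn; lia|].
  change (pred (fv (Nat.iter n FAll p)) = fv p - S n). lia.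
Qed.

Lemma models0_of_nf p : inh (Vs (fv p)) (denot_nf p) -> V_models 0 p.
Proof.
  intros H. apply inh_closure in H. destruct H as [t Ht]. exists t. unfold closed_tm.
  rewrite (interp_denot _ _ _ (fun n => n)).
  - rewrite ren_as_subst, subst_var by reflexivity. exact Ht.
  - rewrite fv_closure. lia.
Qed.

Lemma models0_of_denot p : inh (Vs (fv p)) (denot p) -> V_models 0 p.
Proof.
  intros [t Ht]. apply models0_of_nf. exists t.
  eapply T_conv; [exact Ht | apply denot_conv |].
  pose proof (denot_nf_type p (Vs (fv p)) (fun n => n)) as H.
  rewrite ren_as_subst, subst_var in H by reflexivity. apply H.
  intros m Hm. apply nth_error_repeat, Hm.
Qed.

Lemma models0_of_closed (T : stm -> stm) p : mem_instance T -> (⊢ forall_mem T) ->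
  fv p = 0 -> denot_nf p = closed_tm (T mem0) -> V_models 0 p.
Proof.
  intros HT H Hp E. apply models0_of_nf. rewrite Hp, E. apply forall_mem_elim; assumption.
Qed.

(** The depth [n] may be a variable: its occurrences are stuck alike on both sides. *)
Lemma shift_mem i n : shift i (mem 0 n) = mem i n.
Proof. reflexivity. Qed.

Lemma shift_interp i p : forall e e' n,
  (forall m, m < fv p -> forall k, shift i (e m k) = e' m k) ->
  shift i (interp 0 p e n) = interp i p e' n.
Proof.
  assert (Hup : forall e e' n N, (forall m, m < pred N -> forall k, shift i (e m k) = e' m k) ->
     forall m, m < N -> forall k, shift i (scons (sVar n) e m k) = scons (sVar n) e' m k).
  { intros e e' n N H [|m] Hm k; cbn [scons]; [reflexivity | apply H; lia]. }
  induction p; intros e e' n H; cbn [fv] in H; cbn -[mem];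
    unfold prod, ex, sig, tId, sPi, sApp, sLam; cbn -[mem].
  - rewrite !H by lia. reflexivity.
  - rewrite !H, shift_mem by lia. reflexivity.
  - rewrite (IHp e e') by exact H. reflexivity.
  - rewrite (IHp1 e e'), (IHp2 e e') by (intros; apply H; lia). reflexivity.
  - rewrite !(IHp1 e e'), (IHp2 e e') by (intros; apply H; lia). reflexivity.
  - rewrite (IHp1 e e'), (IHp2 e e') by (intros; apply H; lia). reflexivity.
  - rewrite (IHp _ (scons (sVar n) e')); [reflexivity | apply Hup, H].
  - rewrite (IHp _ (scons (sVar n) e')); [reflexivity | apply Hup, H].
Qed.

Lemma models_of_models0 i p : V_models 0 p -> V_models i p.
Proof.
  intros [t Ht]. exists (shift i t). apply (shift_has_type i) in Ht. cbn in Ht.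
  unfold closed_tm in *. erewrite shift_interp in Ht; [exact Ht|].
  rewrite fv_closure. lia.
Qed.

(** * The axiom schemes *)

(** Bounds the variables of a parameter formula by those of the axiom, in which it
    occurs renamed. *)
Lemma fv_fren p : forall r N N', (forall m, r m < N -> m < N') ->
  fv (fren r p) <= N -> fv p <= N'.
Proof.
  assert (Hup : forall r N N', (forall m, r m < N -> m < N') ->
            forall m, upren r m < S N -> m < S N').
  { intros r N N' H [|m] Hm; cbn in Hm; [lia|]. assert (m < N') by (apply H; lia). lia. }
  induction p; intros r N N' H Hr; cbn [fv fren] in *;
  try (assert (x < N') by (apply H; lia); assert (y < N') by (apply H; lia); lia);
  try (specialize (IHp1 r N N' H); specialize (IHp2 r N N' H); lia);
  try (specialize (IHp _ _ _ (Hup _ _ _ H)); lia).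
  exact (IHp r N N' H Hr).
Qed.

Lemma inh_all q n : fv q <= S n -> inh (Vs (S n)) (denot q) -> inh (Vs n) (denot (FAll q)).
Proof.
  intros Hq [t Ht]. exists (Lam tV t). cbn [denot]. eapply T_conv with (i := 1).
  - eapply T_lam; [apply tV_type | exact Ht].
  - apply conv_sym. eapply conv_trans; [apply conv_beta|].
    apply conv_pi; [apply conv_refl | apply (conv_family q)].
  - apply (denot_type (FAll q) n). cbn. lia.
Qed.

Definition iff_fn (P Q : stm) : stm := and_fn @ (imp_fn @ P @ Q) @ (imp_fn @ Q @ P).

Lemma denot_separation : ⊢ Π φ : V ~> U 1, (props_fn @ φ) ~> (smalls_fn @ φ) ~> Π y : V,
  ex_fn @ λ w : V, all_fn @ λ x : V,
    iff_fn (mem0 @ x @ w) (and_fn @ (mem0 @ x @ y) @ (φ @ x)).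
Proof.
  refine (forall_mem_elim (fun m =>
    Π φ : V ~> U 1, (props_fn @ φ) ~> (smalls_fn @ φ) ~> Π y : V,
    ex_fn @ λ w : V, all_fn @ λ x : V,
      iff_fn (m @ x @ w) (and_fn @ (m @ x @ y) @ (φ @ x)))%hott _ _); [mem_instance|].
  use separation. prove (fn separation => separation).
Qed.

Definition props2_fn : stm := λ φ : V ~> V ~> U 1, Π x : V, Π y : V, isProp_fn @ (φ @ x @ y).

Lemma denot_replacement : ⊢ Π φ : V ~> V ~> U 1, (props2_fn @ φ) ~> Π S : V,
  imp_fn
    @ (all_fn @ λ x : V, ex_fn @ λ y : V,
         and_fn @ (φ @ x @ y) @ (all_fn @ λ z : V, imp_fn @ (φ @ x @ z) @ tId 1 V z y))
    @ (ex_fn @ λ w : V, all_fn @ λ v : V,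
         iff_fn (mem0 @ v @ w) (ex_fn @ λ u : V, and_fn @ (mem0 @ u @ S) @ (φ @ u @ v))).
Proof.
  refine (forall_mem_elim (fun m => Π φ : V ~> V ~> U 1, (props2_fn @ φ) ~> Π S : V,
    imp_fn
      @ (all_fn @ λ x : V, ex_fn @ λ y : V,
           and_fn @ (φ @ x @ y) @ (all_fn @ λ z : V, imp_fn @ (φ @ x @ z) @ tId 1 V z y))
      @ (ex_fn @ λ w : V, all_fn @ λ v : V,
           iff_fn (m @ v @ w) (ex_fn @ λ u : V, and_fn @ (m @ u @ S) @ (φ @ u @ v))))%hott
    _ _); [mem_instance|].
  use replacement. prove (fn replacement => replacement).
Qed.

(** The instance of a closed statement at [φ := family p] differs from the
    denotation of the axiom only by redexes [φ x] or [φ x y] with variables as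
    arguments; these reduce to renamings of [denot p]. *)
Ltac by_renaming :=
  apply conv_of_eq; unfold subst1, lift; rewrite ?ren_ren, ?ren_as_subst;
  repeat rewrite subst_subst; first [apply subst_ext | apply subst_var];
  intros [|[|[|k]]]; reflexivity.
Ltac conv_app1 := eapply conv_trans; [apply conv_beta|]; by_renaming.
Ltac conv_app2 :=
  eapply conv_trans; [apply conv_app; [apply conv_beta | apply conv_refl]|]; conv_app1.
Ltac conv_up_to_redexes :=
  repeat first [apply conv_refl | solve [conv_app1] | solve [conv_app2]
               | apply conv_lam | apply conv_app].

Lemma separation_model p : Delta0 p -> V_models 0 (ax_separation p).
Proof.
  intros D. unfold ax_separation.
  match goal with |- V_models 0 (FAll ?q) => set (body := q) end.
  apply models0_of_denot. set (n := fv (FAll body)).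
  assert (Hb : fv body <= S n) by (subst n; cbn [fv]; lia).
  assert (Hp : fv p <= S (S n)).
  { apply (fv_fren p (upren S) (S (S (S n)))); [intros [|m]; cbn; lia|].
    subst body. cbn [fv FIff] in Hb. lia. }
  apply inh_all; [exact Hb|].
  destruct (denot_props p (S n) Hp) as [t Ht].
  destruct (denot_smalls p (S n) Hp (denot_isSmall p D _ Hp)) as [u Hu].
  start denot_separation. inst H ltac:(apply (family_type p); lia). inst H ltac:(exact Ht).
  inst H ltac:(exact Hu).
  (* the set to be separated from is the innermost variable of the context *)
  inst H ltac:(apply Vs_var with (k := 0); lia).
  eexists. eapply T_conv with (i := 1); [| |apply denot_type, Hb].
  - cbn in H. unfold mem0 in H. rewrite !subst_Mem in H. exact H.
  - subst body. cbn [denot FIff]. rewrite denot_fren. conv_up_to_redexes.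
Qed.

Lemma family2_type p n : fv p <= S (S n) ->
  has_type (Vs n) (Lam tV (family p)) (Pi tV (Pi tV (Univ 1))).
Proof. intros H. eapply T_lam; [apply tV_type | apply (family_type p (S n)), H]. Qed.

Lemma denot_props2 p n : fv p <= S (S n) -> inh (Vs n) (App (props2_fn 0) (Lam tV (family p))).
Proof.
  intros Hp. destruct (denot_isProp p _ Hp) as [t Ht]. exists (Lam tV (Lam tV t)).
  eapply T_conv with (i := 1).
  - eapply T_lam; [apply tV_type|]. eapply T_lam; [apply tV_type | exact Ht].
  - apply conv_sym. eapply conv_trans; [apply conv_beta|].
    apply conv_pi; [apply conv_refl|]. apply conv_pi; [apply conv_refl|].
    apply conv_app; [apply conv_refl|]. cbn. conv_app2.
  - eapply (T_app _ (Pi tV (Pi tV (Univ 1))) (Univ 1)); [by_check | apply family2_type, Hp].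
Qed.

Lemma replacement_model p : V_models 0 (ax_replacement p).
Proof.
  unfold ax_replacement.
  match goal with |- V_models 0 (FAll ?q) => set (body := q) end.
  apply models0_of_denot. set (n := fv (FAll body)).
  assert (Hb : fv body <= S n) by (subst n; cbn [fv]; lia).
  assert (Hp : fv p <= S (S (S n))) by (subst body; cbn [fv FExUnique] in Hb; lia).
  apply inh_all; [exact Hb|].
  destruct (denot_props2 p (S n) Hp) as [t Ht].
  start denot_replacement. inst H ltac:(apply (family2_type p (S n)); lia).
  inst H ltac:(exact Ht). inst H ltac:(apply Vs_var with (k := 0); lia).
  eexists. eapply T_conv with (i := 1); [| |apply denot_type, Hb].
  - cbn in H. unfold mem0 in H. rewrite !subst_Mem in H. exact H.
  - subst body. cbn [denot FExUnique FIff FExIn]. rewrite !denot_fren. conv_up_to_redexes.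
Qed.

Ltac closed_axiom l :=
  match type of l with inhabited_in_HoTT (forall_mem ?T) =>
    apply (models0_of_closed T); [mem_instance | exact l | reflexivity | simp_Mem; reflexivity]
  end.

(* For every universe U = U_i of HoTT, with U' = U_(i+1) *)
Theorem theorem5 (i : nat) (chi : formula) (axiom : ECST chi) : V_models i chi.
Proof.
  apply models_of_models0. destruct axiom.
  - closed_axiom extensionality.
  - closed_axiom empty_set.
  - closed_axiom pairing.
  - closed_axiom union.
  - closed_axiom strong_infinity.
  - apply separation_model; assumption.
  - apply replacement_model.
Qed.
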